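(* Let $p\ge1$, $k\ge1$ an integer and $\varepsilon,\delta\in(0,1)$. Any algorithm that accesses a real square matrix ${\bm{A}}$ via non-adaptive matrix-vector multiplication queries, where each entry of the query vectors is specified by $k$ bits, and that for every real square matrix ${\bm{A}}$ outputs an estimate $t$ such that with probability at least $1-\delta$, $|t-\operatorname{tr}({\bm{A}})|\le\varepsilon\|{\bm{A}}\|_p$, requires at least $$\Omega\!\left(\frac{\log^{p/2}(1/\delta)}{\varepsilon^p(k+\log(1/\varepsilon))}\right)$$ queries.
   Context: $\|\cdot\|_p$ is the Schatten-$p$ norm (the $\ell_p$ norm of the singular values). Non-adaptive queries: the query vectors $q_1,\dots,q_r$ are chosen (possibly at random) before any answer is seen, and the algorithm receives ${\bm{A}}q_1,\dots,{\bm{A}}q_r$ and outputs $t$ from these; each entry of each query vector is specified using $k$ bits.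
   Formalization: The constant in Ω may depend on p and on an upper bound δ₀<1 for δ (any δ₀<1 is allowed, δ∈(0,δ₀]), since no single constant works as δ→1; the bound is shown for the number of queries in some dimension n≥1. *)

(* Defs.v *)
From HB Require Import structures.
From mathcomp Require Import all_boot all_order all_algebra.
From mathcomp Require Import all_classical all_reals all_analysis.
From mathcomp Require Import complex.

Set Implicit Arguments.
Unset Strict Implicit.
Unset Printing Implicit Defensive.

Import Order.TTheory GRing.Theory Num.Theory.
Import numFieldNormedType.Exports.

Local Open Scope classical_set_scope.
Local Open Scope ring_scope.

(* A^T A is sent into R[i] only because spectral_diag is available over
   algebraically closed fields; the lemma below shows that these are indeed
   the square roots of the eigenvalues of A^T A, with multiplicity. *)
Definition singular_value (R : realType) (n : nat) (A : 'M[R]_n) (i : 'I_n) : R :=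
  Num.sqrt (complex.Re
    (spectral_diag (map_mx (real_complex R) (A^T *m A)) ord0 i)).

Lemma char_poly_singular_value (R : realType) (n : nat) (A : 'M[R]_n) :
  char_poly (A^T *m A) = \prod_(i < n) ('X - (singular_value A i ^+ 2)%:P).
Proof.
set B := A^T *m A.
set C := map_mx (real_complex R) B.
have Csym : C^T = C.
  by rewrite /C map_trmx /B trmx_mul trmxK.
have Creal : C \is a realmx.
  apply/mxOverP => i j; rewrite mxE; apply/CrealP; by simpc.
have Ch : C \is hermsymmx.
  apply: realsym_hermsym => //.
  by apply/is_hermitianmxP; rewrite expr0 scale1r map_mx_id// Csym.
have CE := orthomx_spectralP (hermitian_normalmx Ch).
have sr := hermitian_spectral_diag_real Ch.
set P := spectralmx C in CE; set d := spectral_diag C in CE sr.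
have PU : P \is unitarymx by apply: spectral_unitarymx.
have d_ge0 i : 0 <= d ord0 i.
  have : P *m C *m invmx P = diag_mx d.
    rewrite [in LHS]CE !mulmxA mulmxV ?spectral_unit// mul1mx mulmxK//.
    exact: spectral_unit.
  move/matrixP/(_ i i); rewrite [in RHS]mxE eqxx mulr1n => <-.
  set M := map_mx (real_complex R) A *m invmx P.
  have -> : P *m C *m invmx P = (map_mx Num.conj M)^T *m M.
    rewrite /C /B map_mxM /M !mulmxA; congr (_ *m _ *m _).
    rewrite map_mxM trmx_mul invmx_unitary//; congr (_ *m _).
      apply/matrixP => a b; rewrite !mxE; symmetry; exact: conjCK.
    apply/matrixP => a b; rewrite !mxE; symmetry; apply/(CrealP); by apply/complex_realP; eexists.
  rewrite mxE sumr_ge0// => j _; rewrite !mxE mulrC; exact: mul_conjC_ge0.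
have dE i : d ord0 i = real_complex R (singular_value A i ^+ 2).
  rewrite /singular_value -/B -/C -/d; have := d_ge0 i.
  case: (d ord0 i) => a b; rewrite lecE /= => /andP[/eqP -> a0].
  by rewrite sqr_sqrtr.
apply: (map_poly_inj (real_complex R)).
rewrite map_char_poly -/C rmorph_prod /=.
under eq_bigr do rewrite rmorphB /= map_polyX map_polyC /= -dE.
have Peq : \det (char_poly_mx C) = \det (char_poly_mx (diag_mx d)).
  have -> : char_poly_mx C = map_mx polyC (invmx P) *m char_poly_mx (diag_mx d) *m map_mx polyC P.
    rewrite /char_poly_mx [in LHS]CE mulmxBr mulmxBl -!map_mxM; congr (_ - _).
    by rewrite mul_mx_scalar -scalemxAl -map_mxM mulVmx ?spectral_unit// map_mx1 scalemx1.
  rewrite !det_mulmx mulrAC -det_mulmx -map_mxM mulVmx ?spectral_unit//.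
  by rewrite map_mx1 det1 mul1r.
rewrite /char_poly Peq.
have -> : char_poly_mx (diag_mx d) = diag_mx (\row_i ('X - (d ord0 i)%:P)).
  apply/matrixP => i j; rewrite !mxE; case: eqP => _; rewrite ?mulr1n ?mulr0n ?subr0//.
by rewrite det_diag; apply: eq_bigr => i _; rewrite mxE.
Qed.

Definition schatten_norm (R : realType) (n : nat) (p : R) (A : 'M[R]_n) : R :=
  (\sum_(i < n) singular_value A i `^ p) `^ p^-1.

(* A possibly randomized algorithm making r non-adaptive queries to an n x n
   matrix.  The probability space carries all of the algorithm's internal
   randomness.  Query vectors depend on this randomness only; each of their
   entries is a k-bit word, and alg_decode, an arbitrary number format with
   k-bit words, tells which real number a word denotes.  The output depends on
   the randomness (hence may use the queries) and on the answers. *)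
Record nonadaptive_alg (R : realType) (n r k : nat) := NonadaptiveAlg {
  alg_display : measure_display;
  alg_space : measurableType alg_display;
  alg_prob : probability alg_space R;
  alg_decode : k.-tuple bool -> R;
  alg_query : {mfun alg_space >-> r.-tuple (n.-tuple (k.-tuple bool))};
  alg_output : {mfun (alg_space * r.-tuple (n.-tuple R))%type >-> R}
}.

Section Run.
Variables (R : realType) (n r k : nat) (alg : nonadaptive_alg R n r k).

Definition query_vector (w : alg_space alg) (j : 'I_r) : 'cV[R]_n :=
  \col_(i < n) alg_decode alg (tnth (tnth (alg_query alg w) j) i).

Definition answers (A : 'M[R]_n) (w : alg_space alg) : r.-tuple (n.-tuple R) :=
  [tuple [tuple (A *m query_vector w j) i ord0 | i < n] | j < r].

Definition estimate (A : 'M[R]_n) (w : alg_space alg) : R :=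
  alg_output alg (w, answers A w).

Definition accurate (p eps delta : R) (A : 'M[R]_n) : Prop :=
  ((1 - delta)%:E <= alg_prob alg
     [set w | (`|estimate A w - \tr A| <= eps * schatten_norm p A)%R])%E.

End Run.

(* Main.v *)
Require Import Defs.
From HB Require Import structures.
From mathcomp Require Import all_boot all_order all_algebra.
From mathcomp Require Import all_classical all_reals all_analysis.
From mathcomp Require Import measurable_realfun ring lra zify.
Import Order.TTheory GRing.Theory Num.Theory.
Import numFieldNormedType.Exports.
Local Open Scope ring_scope.

Set Implicit Arguments.
Unset Strict Implicit.

(** Let [H] be the orthogonal projection onto the complement of the span of the
    query vectors: [A] and [A + s H] produce the same answers, although their
    traces differ by [s tr H >= s (n - r)].  Take [A] with independent discrete
    Gaussian entries, so that [A] has operator norm [O(sqrt n)], and let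
    [s ~ sqrt (ln (1/delta) / n)].  The density of [A] then changes by a factor of
    at least [sqrt delta] along boundedly many shifts [A + j s H], so two of them
    are simultaneously estimated accurately for the same coins, which forces
    [s n <= O(eps n^(1/p) (sqrt n + s))].  For [n ~ ln(1/delta)^(p/2) / eps^p] and
    [2 r <= n] this is impossible; the number [k] of bits plays no role here.

    Only [p = 1] with [eps] bounded away from [0] escapes this argument (the term
    [s] on the right is too large).  There one guesses the queries: the matrices
    [H] and [- H] cannot both be estimated, and there are only [2^(k n r)]
    possible query tuples, whence [ln (1/delta) <= k n r + 1] as soon as [r < n]. *)

(** * Averaging over the coins of the algorithm *)

Section Averaging.
Local Open Scope classical_set_scope.

Lemma measurable_set1_tuple_bool (k : nat) (t : k.-tuple bool) :
  measurable [set t].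
Proof.
have -> : [set t] = \big[setI/setT]_(i < k) ((fun u => tnth u i) @^-1` [set tnth t i]).
  apply/seteqP; split => [_ ->|u].
    by apply: (big_ind (fun S : set _ => S t)).
  rewrite -bigcap_seq => H; apply: eq_from_tnth => i.
  by apply: (H i); rewrite /= mem_index_enum.
apply: bigsetI_measurable => i _.
rewrite -[X in measurable X]setTI; exact: measurable_tnth.
Qed.

(** The number format is an arbitrary function of the word. It is measurable because there are
    finitely many words and each singleton is measurable. *)
Lemma measurable_fun_tuple_bool d (T : measurableType d) (k : nat)
    (f : k.-tuple bool -> T) : measurable_fun setT f.
Proof.
move=> _ Y _; rewrite setTI.
have -> : f @^-1` Y = \bigcup_(t in f @^-1` Y) [set t].
  by apply/seteqP; split => [t Yt|t [u Yu ->//]]; exists t.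
apply: fin_bigcup_measurable => [|t _]; first exact: finite_finset.
exact: measurable_set1_tuple_bool.
Qed.

Variables (R : realType) (n r k : nat) (alg : nonadaptive_alg R n r k).

Lemma measurable_estimate (A : 'M[R]_n) :
  measurable_fun setT (estimate (alg := alg) A).
Proof.
rewrite /estimate; apply: measurableT_comp => //.
apply: measurable_fun_pair => //.
apply/measurable_fun_tnthP => j; apply/measurable_fun_tnthP => i.
rewrite (_ : _ \o _ = fun w => \sum_l A i l *
    alg_decode alg (tnth (tnth (alg_query alg w) j) l)); last first.
  apply/funext => w /=; rewrite !tnth_mktuple mxE.
  by apply: eq_bigr => l _; rewrite mxE.
apply: measurable_sum => l; apply: measurable_funM => //.
apply: (measurableT_comp (measurable_fun_tuple_bool _)).
apply: (measurableT_comp (measurable_tnth _)).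
apply: (measurableT_comp (measurable_tnth _)).
exact: measurable_funPT.
Qed.

Lemma measurable_accurate_event (A : 'M[R]_n) (e : R) :
  measurable [set w | `|estimate (alg := alg) A w - \tr A| <= e].
Proof.
have mf : measurable_fun setT (fun w => `|estimate (alg := alg) A w - \tr A|).
  apply: measurableT_comp => //; apply: measurable_funB => //.
  exact: measurable_estimate.
rewrite -[X in measurable X]setTI.
have -> : [set w | `|estimate (alg := alg) A w - \tr A| <= e] =
  (fun w => `|estimate (alg := alg) A w - \tr A|) @^-1` `]-oo, e].
  by apply/seteqP; split => w /=; rewrite in_itv.
exact: mf.
Qed.

Definition accurate_at (p eps : R) (A : 'M[R]_n) (w : alg_space alg) : bool :=
  `|estimate A w - \tr A| <= eps * schatten_norm p A.

(** First-moment argument: averaged over the coins, the [mu]-weight of the badly estimated inputs is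
    at most [delta] times the total, so some coin value does no worse. Fixing it makes the algorithm
    deterministic, queries included. *)
Lemma exists_few_inaccurate (p eps delta C : R) (I : finType) (mu : I -> R)
    (A : I -> 'M[R]_n) :
  0 <= delta -> (forall i, 0 <= mu i) ->
  (forall i, accurate alg p eps delta (A i)) ->
  delta * (\sum_i mu i) < C ->
  exists w, \sum_(i | ~~ accurate_at p eps (A i) w) mu i < C.
Proof.
move=> d0 mu0 Aacc dC; apply/not_existsP => Hw.
pose B i := [set w | ~~ accurate_at p eps (A i) w].
have mB i : measurable (B i).
  have -> : B i = ~` [set w | `|estimate (alg := alg) (A i) w - \tr (A i)| <=
      eps * schatten_norm p (A i)].
    by apply/seteqP; split => w /= /negP.
  exact/measurableC/measurable_accurate_event.
have PB i : (alg_prob alg (B i) <= delta%:E)%E.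
  have -> : B i = ~` [set w | `|estimate (alg := alg) (A i) w - \tr (A i)| <=
      eps * schatten_norm p (A i)].
    by apply/seteqP; split => w /= /negP.
  rewrite probability_setC; last exact: measurable_accurate_event.
  have := Aacc i; rewrite /accurate.
  have fP : alg_prob alg [set w | `|estimate (alg := alg) (A i) w - \tr (A i)| <=
      eps * schatten_norm p (A i)] \is a fin_num.
    by apply: fin_num_measure; exact: measurable_accurate_event.
  by rewrite EFinB !leeBlDr// addeC.
have mf i : measurable_fun setT (fun w => (mu i * \1_(B i) w)%:E).
  by apply/measurable_EFinP; apply: measurable_funM => //; exact: measurable_indic.
have f0 i w : (0 <= (mu i * \1_(B i) w)%:E)%E by rewrite lee_fin mulr_ge0.
have : (C%:E <= \int[alg_prob alg]_w (\sum_i (mu i * \1_(B i) w)%:E))%E.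
  rewrite -[leLHS]mule1 -(@probability_setT _ _ _ (alg_prob alg)) -integral_cst//.
  have C0 : 0 <= C.
    by rewrite (le_trans _ (ltW dC))// mulr_ge0// sumr_ge0.
  apply: ge0_le_integral => //=.
  - exact: emeasurable_sum.
  - move=> w _; rewrite sumEFin lee_fin.
    have /negP := Hw w; rewrite -leNgt => /le_trans; apply.
    rewrite big_mkcond/=; apply: ler_sum => i _.
    rewrite indicE; case: ifPn => Bi; last by rewrite mulr_ge0.
    by rewrite mem_set// mulr1.
rewrite ge0_integral_sum//.
apply/negP; rewrite -ltNge (@le_lt_trans _ _ (\sum_i (mu i * delta)%:E)%E)//;
    last first.
  by rewrite sumEFin lte_fin -mulr_suml mulrC.
apply: lee_sum => i _.
rewrite (integralZl_indic _ (fun=> B i))//; last by rewrite ltNge mu0.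
rewrite integral_indic// setIT EFinM; apply: lee_wpmul2l (PB i).
by rewrite lee_fin.
Qed.
End Averaging.

(** * Projections and Schatten norms *)

Section Projection.
Variable R : realType.

Lemma mxtrace_trmx_mul_eq0 (m n : nat) (B : 'M[R]_(m, n)) :
  \tr (B *m B^T) = 0 -> B = 0.
Proof.
move=> /eqP; rewrite /mxtrace psumr_eq0; last first.
  by move=> i _; rewrite mxE sumr_ge0// => j _; rewrite mxE -expr2 sqr_ge0.
move=> /allP B0; apply/matrixP => i j; rewrite mxE.
have := B0 i (mem_index_enum _) => /=; rewrite mxE psumr_eq0; last first.
  by move=> l _; rewrite mxE -expr2 sqr_ge0.
move=> /allP /(_ j (mem_index_enum _)) /=.
by rewrite mxE -expr2 sqrf_eq0 => /eqP.
Qed.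

(** If U K K^T = 0 then (U K)(U K)^T = 0, whose trace is a sum of squares; hence U K = 0, and
    freeness of the rows gives U = 0. *)
Lemma gram_unitmx (m n : nat) (K : 'M[R]_(m, n)) :
  row_free K -> K *m K^T \in unitmx.
Proof.
move=> Kfree; rewrite -row_free_unit -kermx_eq0; apply/eqP.
set U := kermx _.
have UKK : U *m (K *m K^T) = 0 by exact: mulmx_ker.
have UK0 : U *m K = 0.
  apply: mxtrace_trmx_mul_eq0.
  by rewrite trmx_mul mulmxA -[U *m K *m _]mulmxA UKK mul0mx mxtrace0.
by apply: (row_free_inj Kfree); rewrite UK0 mul0mx.
Qed.

(** Take for the rows of [K] a basis of the left kernel of [Q]; then K^T (K K^T)^-1 K projects
    orthogonally onto their span. By cyclicity its trace is the number of rows, at least n - r. *)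
Lemma exists_projection (n r : nat) (Q : 'M[R]_(n, r)) :
  exists H : 'M[R]_n, [/\ H *m Q = 0, H^T = H, H *m H = H & (n - r)%:R <= \tr H].
Proof.
have [m [K [Kfree KQ nrm]]] : exists m (K : 'M[R]_(m, n)),
    [/\ row_free K, K *m Q = 0 & (n - r <= m)%N].
  exists (\rank (kermx Q)), (row_base (kermx Q)); split.
  - exact: row_base_free.
  - by apply: sub_kermxP; rewrite eq_row_base.
  - by rewrite mxrank_ker leq_sub2l// rank_leq_col.
have Gu := gram_unitmx Kfree.
have GT : (K *m K^T)^T = K *m K^T by rewrite trmx_mul trmxK.
exists (K^T *m invmx (K *m K^T) *m K); split.
- by rewrite -mulmxA KQ mulmx0.
- by rewrite !trmx_mul trmxK trmx_inv GT mulmxA.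
- by rewrite !mulmxA -[_ *m K *m K^T]mulmxA mulmxKV.
- by rewrite -mulmxA mxtrace_mulC -mulmxA mulVmx// mxtrace1 ler_nat.
Qed.

Section WithProjection.
Variables (n : nat) (H : 'M[R]_n).
Hypotheses (HT : H^T = H) (HH : H *m H = H).

Lemma projection_sqr_sum : \sum_i \sum_j H i j ^+ 2 = \tr H.
Proof.
rewrite -[in RHS]HH /mxtrace; apply: eq_bigr => i _; rewrite mxE.
by apply: eq_bigr => j _; rewrite -{3}HT mxE expr2.
Qed.

Lemma projection_diag i : \sum_j H i j ^+ 2 = H i i.
Proof.
rewrite -[in RHS]HH mxE; apply: eq_bigr => j _.
by rewrite -{3}HT mxE expr2.
Qed.

(** The diagonal identity gives H_ii^2 <= H_ii, so H_ii <= 1; then H_ij^2 is one term of a sum equal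
    to H_ii. *)
Lemma projection_entry i j : `|H i j| <= 1.
Proof.
have Hii : H i i <= 1.
  have := projection_diag i; rewrite (bigD1 i)//= => E.
  have : H i i ^+ 2 <= H i i by rewrite -{2}E ler_wpDr// sumr_ge0// => ? _;
      rewrite sqr_ge0.
  nra.
have : H i j ^+ 2 <= 1.
  rewrite (le_trans _ Hii)// -projection_diag (bigD1 j)//= ler_wpDr// sumr_ge0// => ? _.
  by rewrite sqr_ge0.
by rewrite -[in leLHS]real_normK ?num_real// expr_le1.
Qed.

Lemma mxtrace_projection_le : \tr H <= n%:R.
Proof.
rewrite /mxtrace -[leRHS]mulr1 mulr_natl -[n in leRHS]card_ord -sumr_const.
by apply: ler_sum => i _; rewrite (le_trans (ler_norm _))// projection_entry.
Qed.

End WithProjection.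

Lemma root_singular_value (n : nat) (A : 'M[R]_n) i :
  eigenvalue (A^T *m A) (singular_value A i ^+ 2).
Proof.
rewrite eigenvalue_root_char char_poly_singular_value /root horner_prod.
by rewrite (bigD1 i)//= hornerXsubC subrr mul0r.
Qed.

Lemma singular_value_ge0 (n : nat) (A : 'M[R]_n) i : 0 <= singular_value A i.
Proof. exact: sqrtr_ge0. Qed.

Lemma singular_valueP (n : nat) (A : 'M[R]_n) i :
  exists2 u : 'rV[R]_n, u != 0 & u *m (A^T *m A) = singular_value A i ^+ 2 *: u.
Proof. by have /eigenvalueP[u uE u0] := root_singular_value A i; exists u. Qed.

(** Both sides are minus the second-highest coefficient of the characteristic polynomial of A^T A,
    which exists only in positive dimension. *)
Lemma sum_singular_value_sqr (n : nat) (A : 'M[R]_n) :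
  \sum_i singular_value A i ^+ 2 = \tr (A^T *m A).
Proof.
case: n A => [|n] A; first by rewrite /mxtrace !big_ord0.
have := char_poly_trace (A^T *m A) (ltn0Sn n).
rewrite char_poly_singular_value /=.
pose ps := [seq singular_value A i ^+ 2 | i <- enum 'I_n.+1].
have sps : size ps = n.+1 by rewrite size_map size_enum_ord.
have -> : \prod_(i < n.+1) ('X - (singular_value A i ^+ 2)%:P) =
          \prod_(x <- ps) ('X - x%:P) by rewrite big_map big_enum.
have := @coefPn_prod_XsubC _ ps; rewrite sps /= => -> // /oppr_inj <-.
by rewrite big_map big_enum.
Qed.

(** Idempotence forces each singular value x to satisfy x^4 = x^2, so x is 0 or 1 and equals its
    square; the squares sum to the trace of H^T H = H. *)
Lemma schatten1_projection (n : nat) (H : 'M[R]_n) :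
  H^T = H -> H *m H = H -> schatten_norm 1 H = \tr H.
Proof.
move=> HT HH; rewrite /schatten_norm invr1.
have sv i : singular_value H i = singular_value H i ^+ 2.
  have [u u0] := singular_valueP H i; rewrite HT HH => uH.
  have : singular_value H i ^+ 4 = singular_value H i ^+ 2.
    have : u *m H *m H = u *m H by rewrite -mulmxA HH.
    rewrite uH -scalemxAl uH scalerA => /eqP.
    rewrite -subr_eq0 -scalerBl scaler_eq0 (negbTE u0) orbF subr_eq0 => /eqP <-.
    by rewrite -exprD.
  have := singular_value_ge0 H i; move: (singular_value H i) => x x0.
  rewrite (_ : x ^+ 4 = (x ^+ 2) ^+ 2); last by rewrite -exprM.
  move=> /eqP; rewrite eqf_sqr => /orP[/eqP->//|/eqP]; nra.
under eq_bigr do rewrite powRr1 ?singular_value_ge0// sv.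
by rewrite sum_singular_value_sqr HT HH powRr1// -(projection_sqr_sum HT HH)
    sumr_ge0// => i _; rewrite sumr_ge0// => j _; rewrite sqr_ge0.
Qed.

Lemma schatten_normN (n : nat) (p : R) (A : 'M[R]_n) :
  schatten_norm p (- A) = schatten_norm p A.
Proof.
have E : (- A)^T *m - A = A^T *m A 
  by apply/matrixP => i j; rewrite !mxE; apply: eq_bigr => l _; rewrite !mxE mulrNN.
by rewrite /schatten_norm /singular_value E.
Qed.

Lemma schatten_norm_1x1 (p : R) (A : 'M[R]_1) : 0 < p ->
  schatten_norm p A = `|A ord0 ord0|.
Proof.
move=> p0; have : singular_value A ord0 ^+ 2 = `|A ord0 ord0| ^+ 2.
  have := sum_singular_value_sqr A; rewrite big_ord1 => ->.
  by rewrite /mxtrace big_ord1 mxE big_ord1 mxE real_normK ?num_real// expr2.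
move=> /eqP; rewrite eqrXn2// ?singular_value_ge0// => /eqP sv.
rewrite /schatten_norm big_ord1 sv -powRrM mulfV ?gt_eqF//.
by rewrite powRr1.
Qed.
End Projection.

(** * Operator norm bounds through bilinear forms *)

Section OpNorm.
Variables (R : realType) (n : nat).
Implicit Types (X Y : 'M[R]_n) (u v : 'I_n -> R).

Definition bilin X v u : R := \sum_i \sum_j v i * X i j * u j.

(** The variational form of an operator norm bound. Ranging over the unit ball rather than the
    sphere keeps the zero vector available, whence b >= 0 in every dimension. *)
Definition op_le X (b : R) := forall u v,
  \sum_i u i ^+ 2 <= 1 -> \sum_i v i ^+ 2 <= 1 -> bilin X v u <= b.

Lemma bilinDl X v v' u : bilin X (fun i => v i + v' i) u = bilin X v u + bilin X v' u.
Proof.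
rewrite /bilin -big_split; apply: eq_bigr => i _ /=.
by rewrite -big_split; apply: eq_bigr => j _ /=; rewrite !mulrDl.
Qed.

Lemma bilinDr X v u u' : bilin X v (fun i => u i + u' i) = bilin X v u + bilin X v u'.
Proof.
rewrite /bilin -big_split; apply: eq_bigr => i _ /=.
by rewrite -big_split; apply: eq_bigr => j _ /=; rewrite mulrDr.
Qed.

Lemma bilinZ X (a b : R) v u :
  bilin X (fun i => a * v i) (fun i => b * u i) = a * b * bilin X v u.
Proof.
rewrite /bilin mulr_sumr; apply: eq_bigr => i _.
by rewrite mulr_sumr; apply: eq_bigr => j _; ring.
Qed.

Lemma op_le_ge0 X b : op_le X b -> 0 <= b.
Proof.
have Z : \sum_(i < n) (0 : R) ^+ 2 <= 1 by rewrite big1// => i _; rewrite expr0n.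
move=> /(_ (fun=> 0) (fun=> 0) Z Z); rewrite /bilin big1// => i _.
by rewrite big1// => j _; rewrite mulr0.
Qed.

Lemma op_leD X Y a b : op_le X a -> op_le Y b -> op_le (X + Y) (a + b).
Proof.
move=> Xa Yb u v u1 v1; rewrite (_ : bilin _ _ _ = bilin X v u + bilin Y v u).
  by rewrite lerD ?Xa ?Yb.
rewrite /bilin -big_split; apply: eq_bigr => i _ /=.
by rewrite -big_split; apply: eq_bigr => j _ /=; rewrite mxE mulrDr mulrDl.
Qed.

Lemma op_leZ X a (s : R) : 0 <= s -> op_le X a -> op_le (s *: X) (s * a).
Proof.
move=> s0 Xa u v u1 v1; rewrite (_ : bilin _ _ _ = s * bilin X v u).
  by rewrite ler_wpM2l// Xa.
rewrite /bilin mulr_sumr; apply: eq_bigr => i _.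
by rewrite mulr_sumr; apply: eq_bigr => j _; rewrite mxE; ring.
Qed.

Lemma op_leW X a b : a <= b -> op_le X a -> op_le X b.
Proof. by move=> ab Xa u v u1 v1; rewrite (le_trans _ ab)// Xa. Qed.

(** Entrywise, v_i X_ij u_j <= c (v_i^2 + u_j^2) / 2, the difference being a nonnegative combination
    of (v_i - u_j)^2 and (v_i + u_j)^2. Summation produces the factor n. *)
Lemma op_le_entries X (c : R) : (forall i j, `|X i j| <= c) -> op_le X (n%:R * c).
Proof.
move=> Xc u v u1 v1.
have cn0 : 0 <= n%:R * c.
  case: n X Xc u v u1 v1 => [|m] X Xc *; first by rewrite mul0r.
  by rewrite mulr_ge0// (le_trans _ (Xc ord0 ord0)).
apply: (@le_trans _ _ (\sum_i \sum_j (c * (v i ^+ 2 + u j ^+ 2) / 2))).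
  apply: ler_sum => i _; apply: ler_sum => j _.
  have := Xc i j; rewrite ler_norml => /andP[h1 h2].
  have c0 : 0 <= c by lra.
  rewrite -subr_ge0.
  have -> : c * (v i ^+ 2 + u j ^+ 2) / 2 - v i * X i j * u j =
    (c + X i j) * (v i - u j) ^+ 2 / 4 + (c - X i j) * (v i + u j) ^+ 2 / 4 by field.
  by rewrite addr_ge0// mulr_ge0// mulr_ge0 ?sqr_ge0//; lra.
under eq_bigr => i _.
  rewrite -mulr_suml -mulr_sumr big_split /= sumr_const card_ord.
  over.
rewrite -mulr_suml -mulr_sumr big_split /= sumr_const card_ord.
rewrite sumrMnl.
set a := \sum_i v i ^+ 2 in v1 *; set b := \sum_i u i ^+ 2 in u1 *.
rewrite -[a *+ n]mulr_natl -[b *+ n]mulr_natl.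
have : (n%:R * c) * (a + b) <= (n%:R * c) * 2 by rewrite ler_wpM2l//; lra.
lra.
Qed.

(** The form equals the inner product of Hv and Hu, and |Hx|^2 = |x|^2 - |x - Hx|^2 shows that H
    does not increase norms. *)
Lemma op_le_projection (H : 'M[R]_n) : H^T = H -> H *m H = H -> op_le H 1.
Proof.
move=> HT HH u v u1 v1.
pose Hx (x : 'I_n -> R) i := \sum_j H i j * x j.
have HHx x i : \sum_j H i j * Hx x j = Hx x i.
  rewrite /Hx; under eq_bigr do rewrite mulr_sumr.
  rewrite exchange_big /=; apply: eq_bigr => l _.
  rewrite -[in RHS]HH mxE mulr_suml; apply: eq_bigr => j _; ring.
have sym x y : \sum_i x i * Hx y i = \sum_i Hx x i * y i.
  rewrite /Hx; under eq_bigr do rewrite mulr_sumr.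
  rewrite exchange_big /=; apply: eq_bigr => j _.
  rewrite mulr_suml; apply: eq_bigr => i _.
  by rewrite -[in LHS]HT mxE; ring.
have bE : bilin H v u = \sum_i Hx v i * Hx u i.
  transitivity (\sum_i v i * Hx u i).
    apply: eq_bigr => i _; rewrite /Hx mulr_sumr.
    by apply: eq_bigr => j _; ring.
  by rewrite -sym; apply: eq_bigr => i _; rewrite -[in LHS](HHx u i).
have Hle x : \sum_i Hx x i ^+ 2 <= \sum_i x i ^+ 2.
  have E : \sum_i x i * Hx x i = \sum_i Hx x i ^+ 2.
    transitivity (\sum_i x i * Hx (Hx x) i).
      by apply: eq_bigr => i _; rewrite -[in LHS](HHx x i).
    by rewrite sym; apply: eq_bigr => i _; rewrite expr2.
  have : 0 <= \sum_i (x i - Hx x i) ^+ 2 by apply: sumr_ge0 => i _; rewrite sqr_ge0.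
  have -> : \sum_i (x i - Hx x i) ^+ 2 =
    \sum_i x i ^+ 2 - 2 * (\sum_i x i * Hx x i) + \sum_i Hx x i ^+ 2.
    rewrite mulr_sumr -sumrB -big_split; apply: eq_bigr => i _ /=; ring.
  by rewrite E; lra.
rewrite bE; apply: (@le_trans _ _ (\sum_i (Hx v i ^+ 2 + Hx u i ^+ 2) / 2)).
  apply: ler_sum => i _; have := sqr_ge0 (Hx v i - Hx u i); lra.
rewrite -mulr_suml big_split /=.
have := Hle u; have := Hle v; lra.
Qed.

(** For an eigenvector w of X^T X with eigenvalue s^2 and y = Xw, one has |y| = s |w| and y^T X w =
    |y|^2. The normalised pair (y, w) therefore gives the form the value s. *)
Lemma op_le_singular_value X b i : op_le X b -> singular_value X i <= b.
Proof.
move=> Xb; have [w w0 wE] := singular_valueP X i.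
have s0 := singular_value_ge0 X i.
have [->|sN0] := eqVneq (singular_value X i) 0; first exact: op_le_ge0 Xb.
set s := singular_value X i in wE s0 sN0 *.
have sp : 0 < s by rewrite lt_neqAle eq_sym sN0.
pose N := \sum_j w ord0 j ^+ 2.
have Np : 0 < N.
  rewrite lt_neqAle eq_sym sumr_ge0 ?andbT; last by move=> j _; rewrite sqr_ge0.
  apply: contra w0; rewrite psumr_eq0; last by move=> j _; rewrite sqr_ge0.
  move=> /allP h; apply/eqP/matrixP => a j; rewrite mxE (ord1 a).
  by have := h j (mem_index_enum _); rewrite /= sqrf_eq0 => /eqP.
pose y i := \sum_j X i j * w ord0 j.
have yN : \sum_i y i ^+ 2 = s ^+ 2 * N.
  have -> : s ^+ 2 * N = (w *m (X^T *m X) *m w^T) ord0 ord0.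
    rewrite wE -scalemxAl mxE; congr (_ * _); rewrite mxE.
    by apply: eq_bigr => j _; rewrite mxE expr2.
  rewrite mulmxA -mulmxA mxE; apply: eq_bigr => j _.
  rewrite !mxE expr2; congr (_ * _); apply: eq_bigr => l _; rewrite !mxE//.
  by rewrite mulrC.
pose q := Num.sqrt N.
have qp : 0 < q by rewrite sqrtr_gt0.
have qN : q ^+ 2 = N by rewrite sqr_sqrtr// ltW.
have := Xb (fun j => q^-1 * w ord0 j) (fun j => (s * q)^-1 * y j).
rewrite bilinZ.
have -> : bilin X y (fun j => w ord0 j) = s ^+ 2 * N.
  rewrite -yN; apply: eq_bigr => j _.
  rewrite expr2 {3}/y mulr_sumr; apply: eq_bigr => l _; ring.
have -> : (s * q)^-1 * q^-1 * (s ^+ 2 * N) = s.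
  by rewrite -qN; field; rewrite !gt_eqF.
apply.
  under eq_bigr do rewrite exprMn.
  rewrite -mulr_sumr -/N exprVn qN mulVf// gt_eqF//.
under eq_bigr do rewrite exprMn.
by rewrite -mulr_sumr yN exprVn exprMn qN mulVf// mulf_neq0// ?gt_eqF// exprn_gt0.
Qed.

Lemma schatten_norm_op_le (p : R) X b : 0 < p -> op_le X b ->
  schatten_norm p X <= n%:R `^ p^-1 * b.
Proof.
move=> p0 Xb; have b0 := op_le_ge0 Xb.
have bE : b = (b `^ p) `^ p^-1 by rewrite -powRrM mulfV ?gt_eqF// powRr1.
rewrite bE -powRM ?powR_ge0//; apply: ge0_ler_powR => //.
- by rewrite invr_ge0 ltW.
- by rewrite nnegrE sumr_ge0// => i _; rewrite powR_ge0.
- by rewrite nnegrE mulr_ge0// powR_ge0.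
rewrite mulr_natl -[n in leRHS]card_ord -sumr_const; apply: ler_sum => i _.
apply: ge0_ler_powR; rewrite ?nnegrE ?singular_value_ge0// ?(ltW p0)//.
exact: op_le_singular_value.
Qed.

End OpNorm.

(** * Discrete Gaussian vectors *)

Section DiscreteGaussian.
Variables (R : realType) (T : nat) (I : finType) (e : I -> R).
Hypothesis e0 : forall i, 0 <= e i.

Local Notation box := {ffun I -> 'I_(T.*2.+1)}.

(** Indices encode the integers from -T to T. Coordinate [i] carries the truncated discrete Gaussian
    weight of rate [e i]; rate 0 gives the uniform weight. *)
Definition zval (i : 'I_(T.*2.+1)) : R := i%:R - T%:R.

Lemma zval_rev i : zval (rev_ord i) = - zval i.
Proof.
rewrite /zval /= subSS natrB; last by rewrite -ltnS.
by have -> : (T.*2)%:R = T%:R + T%:R :> R; [rewrite -natrD addnn|ring].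
Qed.

(** Moving the centre from m to m + 1 trades the term at T - m for the one at -(T + m + 1), which is
    farther from 0 and so no larger. Negative centres follow by reflection. *)
Lemma sum_gauss_shift (c : R) (mu : int) : 0 <= c ->
  \sum_i expR (- (c * (zval i - mu%:~R) ^+ 2)) <= \sum_i expR (- (c * zval i ^+ 2)).
Proof.
move=> c0.
have pos (m : nat) : \sum_i expR (- (c * (zval i - m%:R) ^+ 2)) <=
    \sum_i expR (- (c * zval i ^+ 2)).
  elim: m => [|m IH]; first by under eq_bigr do rewrite subr0.
  apply: le_trans IH; rewrite [leLHS]big_ord_recl [leRHS]big_ord_recr /= [leLHS]addrC
      lerD//.
    rewrite le_eqVlt; apply/orP; left; apply/eqP; apply: eq_bigr => i _.
    by rewrite /zval lift0 /= -natr1 -[m.+1%:R]natr1; congr (expR (- (_ * _ ^+ 2)));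
        ring.
  rewrite ler_expR lerN2 ler_wpM2l// /zval /= -addnn natrD -natr1.
  have : 0 <= T%:R :> R by []. have : 0 <= m%:R :> R by []. nra.
case: mu => m; first exact: pos.
apply: le_trans (pos m.+1).
rewrite (reindex_inj rev_ord_inj) /= le_eqVlt; apply/orP; left; apply/eqP.
apply: eq_bigr => i _; rewrite zval_rev NegzE mulrNz opprK.
by congr (expR (- (_ * _))); ring.
Qed.

Definition gweight (v : box) : R :=
  \prod_i expR (- (e i * zval (v i) ^+ 2)).

Definition gtotal : R := \sum_v gweight v.

Lemma gweight_ge0 v : 0 <= gweight v.
Proof. by apply: prodr_ge0 => i _; rewrite expR_ge0. Qed.

Lemma gtotal_gt0 : 0 < gtotal.
Proof.
rewrite /gtotal (bigD1 [ffun=> ord0])//= ltr_pwDl//.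
  by apply: prodr_gt0 => i _; rewrite expR_gt0.
by apply: sumr_ge0 => v _; exact: gweight_ge0.
Qed.

Lemma gtotalE : gtotal = \prod_i \sum_j expR (- (e i * zval j ^+ 2)).
Proof. by rewrite bigA_distr_bigA. Qed.

(* Completing the square turns the exponential factor into an integer shift of
   the box, which by [sum_gauss_shift] does not increase the total weight. *)
Lemma gauss_mgf (mu : I -> int) :
  \sum_(v : box) gweight v * expR (2 * \sum_i e i * (mu i)%:~R * zval (v i)) <=
  expR (\sum_i e i * (mu i)%:~R ^+ 2) * gtotal.
Proof.
rewrite gtotalE.
have -> : \sum_(v : box) gweight v * expR (2 * \sum_i e i * (mu i)%:~R * zval (v i)) =
  expR (\sum_i e i * (mu i)%:~R ^+ 2) *
    \sum_(v : box) \prod_i expR (- (e i * (zval (v i) - (mu i)%:~R) ^+ 2)).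
  rewrite mulr_sumr; apply: eq_bigr => v _.
  rewrite /gweight mulr_sumr !expR_sum -!big_split; apply: eq_bigr => i _ /=.
  by rewrite -!expRD; congr expR; ring.
rewrite ler_wpM2l ?expR_ge0// -(bigA_distr_bigA (fun i j => expR (- (e i *
    (zval j - (mu i)%:~R) ^+ 2)))) /=.
apply: ler_prod => i _; rewrite sum_gauss_shift// andbT.
by apply: sumr_ge0 => j _; rewrite expR_ge0.
Qed.

(** Exponential Markov inequality on top of [gauss_mgf]; hence tilts must be integer vectors. *)
Lemma gauss_chernoff (mu : I -> int) (u : R) :
  \sum_(v : box | u <= \sum_i e i * (mu i)%:~R * zval (v i)) gweight v <=
  expR (\sum_i e i * (mu i)%:~R ^+ 2 - 2 * u) * gtotal.
Proof.
rewrite expRD mulrAC -ler_pdivrMr ?expR_gt0// -expRN opprK.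
apply: le_trans (gauss_mgf mu); rewrite mulr_suml [leLHS]big_mkcond /=.
apply: ler_sum => v _; case: ifP => h; last by rewrite mulr_ge0 ?gweight_ge0 ?expR_ge0.
by rewrite ler_wpM2l ?gweight_ge0// ler_expR ler_pM2l.
Qed.

Definition interior (D : nat) (v : box) : bool :=
  [forall i, (D <= v i)%N && (v i + D <= T.*2)%N].

(** The average over [out] is at most the overall average: after cancelling the common part, compare
    f i with f j over all pairs of an [out] and a non-[out] index. *)
Lemma sum_le_card_ratio (J : finType) (out : pred J) (f : J -> R) :
  (forall i j, out i -> ~~ out j -> f i <= f j) ->
  #|J|%:R * (\sum_(i | out i) f i) <= #|out|%:R * (\sum_i f i).
Proof.
move=> fle; rewrite -(cardC out) natrD mulrDl [in leRHS](bigID out) /= mulrDr lerD2l.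
rewrite !mulr_natl -!sumr_const [leLHS]exchange_big /=.
by apply: ler_sum => i oi; apply: ler_sum => j oj; exact: fle.
Qed.

(** The weight decreases away from the centre and at most 2D of the 2T + 1 indices lie near the
    edge, so these carry at most a D/T share of the mass. *)
Lemma sum_gauss_edge (c : R) (D : nat) : 0 <= c -> (D <= T)%N ->
  T%:R * (\sum_(i : 'I_(T.*2.+1) | ~~ ((D <= i)%N && (i + D <=
      T.*2)%N)) expR (- (c * zval i ^+ 2))) <=
  D%:R * (\sum_i expR (- (c * zval i ^+ 2))).
Proof.
move=> c0 DT.
pose out := [pred i : 'I_(T.*2.+1) | ~~ ((D <= i)%N && (i + D <= T.*2)%N)].
have cout : (#|out| <= D.*2)%N.
  have sub : out \subset [predU [pred i : 'I_(T.*2.+1) | (i < D)%N] &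
                            [pred i : 'I_(T.*2.+1) | (rev_ord i < D)%N]].
    apply/fintype.subsetP => i; rewrite !inE /= => h; apply/orP; have := ltn_ord i; lia.
  have cD : #|[pred i : 'I_(T.*2.+1) | (i < D)%N]| = D.
    rewrite -sum1_card -(big_ord_widen _ (fun=> 1%N)) ?sum_nat_const ?card_ord ?muln1//.
    by rewrite -addnn; lia.
  have cD' : #|[pred i : 'I_(T.*2.+1) | (rev_ord i < D)%N]| = D.
    by rewrite -[RHS]cD -!sum1_card [RHS](reindex_inj rev_ord_inj).
  apply: (leq_trans (subset_leq_card sub)).
  have := cardUI [pred i : 'I_(T.*2.+1) | (i < D)%N] [pred i | (rev_ord i < D)%N].
  by rewrite cD cD' addnn => <-; rewrite leq_addr.
have out_le i j : out i -> ~~ out j ->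
    expR (- (c * zval i ^+ 2)) <= expR (- (c * zval j ^+ 2)).
  move=> /= oi; rewrite negbK => oj.
  rewrite ler_expR lerN2 ler_wpM2l//.
  have : (`|j%:Z - T%:Z| <= T%:Z - D%:Z <= `|i%:Z - T%:Z|)%R by have := ltn_ord i; lia.
  move=> /andP[h1 h2]; have := le_trans h1 h2.
  rewrite -(ler_int R) !intr_norm !rmorphB /= -!pmulrn => h.
  by rewrite -(real_normK (num_real (zval j))) -(real_normK (num_real (zval i)))
      lerXn2r ?nnegrE.
have := sum_le_card_ratio out_le; rewrite card_ord /=.
set S1 := \sum_(i | _) _; set S2 := \sum_i _ => h.
have S20 : 0 <= S2 by apply: sumr_ge0 => i _; rewrite expR_ge0.
have S10 : 0 <= S1 by apply: sumr_ge0 => i _; rewrite expR_ge0.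
have : (#|out|%:R : R) * S2 <= (D.*2)%:R * S2 by rewrite ler_wpM2r// ler_nat.
have : (T.*2)%:R * S1 <= (T.*2.+1)%:R * S1 by rewrite ler_wpM2r// ler_nat.
move=> h1 h2; have := le_trans h1 (le_trans h h2).
have dbl m : (m.*2)%:R = 2 * m%:R :> R by rewrite -mul2n natrM.
by rewrite !dbl -!mulrA ler_pM2l.
Qed.

Lemma gauss_edge (D : nat) : (D <= T)%N ->
  T%:R * (\sum_(v | ~~ interior D v) gweight v) <= #|I|%:R * D%:R * gtotal.
Proof.
move=> DT.
pose out (i : 'I_(T.*2.+1)) := ~~ ((D <= i)%N && (i + D <= T.*2)%N).
have one i : T%:R * (\sum_(v : box | out (v i)) gweight v) <= D%:R * gtotal.
  (* Putting the edge indicator into the factor of coordinate [i] keeps the restricted sum a product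
     of one-dimensional sums. *)
  pose g j l := expR (- (e j * zval l ^+ 2)) * (if j == i then (out l)%:R else 1).
  have -> : \sum_(v : box | out (v i)) gweight v =
      \sum_(v : box) \prod_j g j (v j).
    rewrite big_mkcond; apply: eq_bigr => v _; rewrite big_split /=.
    rewrite -/(gweight v) (bigD1 i)//= eqxx big1 ?mulr1; last by move=> j /negbTE->.
    by case: (out (v i)); rewrite ?mulr1 ?mulr0.
  rewrite -(bigA_distr_bigA g) gtotalE (bigD1 i)//= [in leRHS](bigD1 i)//= !mulrA.
  have -> : \prod_(j | j != i) \sum_l g j l =
      \prod_(j | j != i) \sum_l expR (- (e j * zval l ^+ 2)).
    apply: eq_bigr => j ji; apply: eq_bigr => l _.
    by rewrite /g (negbTE ji) mulr1.
  rewrite ler_wpM2r//.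
    by apply: prodr_ge0 => j _; apply: sumr_ge0 => l _; rewrite expR_ge0.
  apply: le_trans (sum_gauss_edge (e0 i) DT); rewrite ler_wpM2l// [leRHS]big_mkcond.
  by apply: ler_sum => l _; rewrite /g eqxx /out; case: ifP; rewrite ?mulr1 ?mulr0.
apply: (@le_trans _ _ (\sum_i T%:R * (\sum_(v : box | out (v i)) gweight v))).
  rewrite -mulr_sumr ler_wpM2l//.
  under [leRHS]eq_bigr do rewrite big_mkcond.
  rewrite exchange_big /= [leLHS]big_mkcond /=; apply: ler_sum => v _.
  have s0 J : 0 <= \sum_(i | J i) (if out (v i) then gweight v else 0).
    by apply: sumr_ge0 => i _; case: ifP => // _; rewrite gweight_ge0.
  case: ifP => [/forallPn[i oi]|_]; last exact: s0.
  by rewrite (bigD1 i)//= /out oi ler_wpDr// s0.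
rewrite -mulrA mulr_natl -sumr_const; apply: ler_sum => i _; exact: one.
Qed.

(** Faithful only where the translated coordinates stay in the box, as on [interior]; elsewhere
    [absz] and [inord] give meaningless indices. *)
Definition shift (b : I -> int) (v : box) : box :=
  [ffun i => inord (absz ((v i)%:Z + b i)%R)].

Lemma shiftE D b v i : interior D v -> (`|b i| <= D)%N ->
  (shift b v i)%:Z = (v i)%:Z + b i.
Proof.
move=> /forallP/(_ i) vD bD; rewrite ffunE inordK; lia.
Qed.

Lemma zval_shift D b v i : interior D v -> (`|b i| <= D)%N ->
  zval (shift b v i) = zval (v i) + (b i)%:~R.
Proof.
move=> vD bD; rewrite /zval addrAC; congr (_ - _).
by have := congr1 (fun z : int => z%:~R : R) (shiftE vD bD); rewrite rmorphD.
Qed.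

Lemma shift_inj D b : (forall i, `|b i| <= D)%N ->
  {in [pred v | interior D v] &, injective (shift b)}.
Proof.
move=> bD u v uD vD uv; apply/ffunP => i; apply/val_inj => /=.
have := shiftE uD (bD i); rewrite uv (shiftE vD (bD i)); lia.
Qed.

Lemma gweight_shift D b v : interior D v -> (forall i, `|b i| <= D)%N ->
  gweight (shift b v) = gweight v *
    expR (- (2 * \sum_i e i * (b i)%:~R * zval (v i)) - \sum_i e i * (b i)%:~R ^+ 2).
Proof.
move=> vD bD; rewrite mulr_sumr -sumrN -sumrB expR_sum -big_split.
apply: eq_bigr => i _ /=; rewrite (zval_shift vD (bD i)) -expRD; congr expR; ring.
Qed.

(** A shift is injective on [interior D], so the left side sums a nonnegative function over a subset
    of the box. *)
Lemma sum_shift_le D b (P : pred box) (F : box -> R) :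
  (forall i, `|b i| <= D)%N -> (forall v, 0 <= F v) ->
  (forall v, P v -> interior D v) ->
  \sum_(v | P v) F (shift b v) <= \sum_v F v.
Proof.
move=> bD F0 PD.
rewrite (eq_bigl (mem P))//.
rewrite -(big_imset (h := shift b) F) /=; last first.
  by move=> u v => /PD uD /PD vD; exact: (shift_inj bD uD vD).
rewrite [leRHS](bigID (mem (shift b @: P))) /= ler_wpDr//.
by apply: sumr_ge0.
Qed.

End DiscreteGaussian.

(** * From an integer net to the operator norm *)

Section Net.
Variables (R : realType) (n : nat) (X : 'M[R]_n) (U : R).
Hypothesis n0 : (0 < n)%N.
Hypothesis Xnet : forall z z' : 'I_n -> int,
  \sum_i (z i)%:~R ^+ 2 <= 25 * n%:R :> R -> \sum_i (z' i)%:~R ^+ 2 <= 25 * n%:R :> R ->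
  bilin X (fun i => (z i)%:~R) (fun i => (z' i)%:~R) <= 16 * n%:R * U.

(** Rounding down to the grid of mesh 1/(4 sqrt n) leaves an error of norm at most 1/4, so the
    rounded vector t has norm at most 5/4 and |z|^2 = 16 n |t|^2 <= 25 n. *)
Lemma round_vector (u : 'I_n -> R) : \sum_i u i ^+ 2 <= 1 ->
  exists z : 'I_n -> int, exists t d : 'I_n -> R,
  [/\ \sum_i (z i)%:~R ^+ 2 <= 25 * n%:R :> R,
      forall i, t i = (4 * Num.sqrt n%:R)^-1 * (z i)%:~R,
      forall i, u i = t i + d i,
      \sum_i (4 * d i) ^+ 2 <= 1 & \sum_i (4 / 5 * t i) ^+ 2 <= 1].
Proof.
move=> u1; pose q : R := Num.sqrt n%:R.
have nR : (0 : R) < n%:R by rewrite ltr0n.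
have qp : 0 < q by rewrite sqrtr_gt0.
have qn : q ^+ 2 = n%:R by rewrite sqr_sqrtr// ltW.
pose z i := Num.floor (4 * q * u i).
pose t i := (4 * q)^-1 * (z i)%:~R.
pose d i := u i - t i.
have d4 i : 0 <= d i * (4 * q) <= 1.
  have -> : d i * (4 * q) = 4 * q * u i - (z i)%:~R.
    by rewrite /d /t; field; rewrite gt_eqF.
  have := floor_itv (4 * q * u i); rewrite -/(z i) intrD1.
  by move=> /andP[]; lra.
have dn i : (4 * d i) ^+ 2 <= n%:R^-1.
  rewrite -qn -[leRHS]mul1r ler_pdivlMr ?exprn_gt0// -exprMn.
  have -> : 4 * d i * q = d i * (4 * q) by ring.
  by have /andP[? ?] := d4 i; rewrite expr_le1.
have d1 : \sum_i (4 * d i) ^+ 2 <= 1.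
  apply: (@le_trans _ _ (\sum_(i < n) n%:R^-1)); first by apply: ler_sum.
  by rewrite sumr_const card_ord -[n%:R^-1 *+ n]mulr_natl mulfV// gt_eqF.
(* Convexity of the square, applied to (4/5) t = (4/5) u - (1/5)(4 d). *)
have t1 : \sum_i (4 / 5 * t i) ^+ 2 <= 1.
  apply: (@le_trans _ _ (\sum_i (4 / 5 * u i ^+ 2 + 1 / 5 * (4 * d i) ^+ 2))).
    apply: ler_sum => i _; rewrite (_ : t i = u i - d i); last by rewrite /d; ring.
    have := sqr_ge0 (u i + 4 * d i); lra.
  rewrite big_split /= -!mulr_sumr; lra.
exists z, t, d; split => //; last by move=> i; rewrite /d; ring.
have -> : \sum_i (z i)%:~R ^+ 2 = 25 * n%:R * \sum_i (4 / 5 * t i) ^+ 2.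
  rewrite mulr_sumr; apply: eq_bigr => i _; rewrite /t -qn.
  by field; rewrite gt_eqF.
by rewrite -[leRHS]mulr1 ler_wpM2l// mulr_ge0.
Qed.

(* Rounding both unit vectors to the grid contracts any operator norm bound [b]. *)
Lemma net_step b : op_le X b -> op_le X (U + 9 / 16 * b).
Proof.
move=> Xb u v u1 v1; have b0 := op_le_ge0 Xb.
have nR : (0 : R) < n%:R by rewrite ltr0n.
have qp : (0 : R) < Num.sqrt n%:R by rewrite sqrtr_gt0.
have [z [t [d [z25 tE uE d1 t1]]]] := round_vector u1.
have [z' [t' [d' [z25' tE' vE d1' t1']]]] := round_vector v1.
(* The first term is a net value. The two error terms cost (1/4)(5/4) b and (1/4) b, together 9/16
   of [b]. *)
have -> : bilin X v u = bilin X t' t + bilin X d' t + bilin X v d.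
  rewrite -bilinDl.
  have -> : bilin X (fun i => t' i + d' i) t = bilin X v t.
    by apply: eq_bigr => i _; apply: eq_bigr => j _; rewrite vE.
  rewrite -bilinDr.
  by apply: eq_bigr => i _; apply: eq_bigr => j _; rewrite uE.
have h1 : bilin X t' t <= U.
  have -> : bilin X t' t = (4 * Num.sqrt n%:R)^-1 * (4 * Num.sqrt n%:R)^-1 *
      bilin X (fun i => (z' i)%:~R) (fun i => (z i)%:~R).
    by rewrite -bilinZ; apply: eq_bigr => i _; apply: eq_bigr => j _; rewrite tE tE'.
  rewrite -invfM -[leRHS]mul1r ler_pdivrMl ?mulr_gt0//.
  have -> : 4 * Num.sqrt n%:R * (4 * Num.sqrt n%:R) = 16 * n%:R :> R.
    by rewrite -[in RHS](sqr_sqrtr (ltW nR)); ring.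
  by rewrite mul1r Xnet.
have h2 : bilin X d' t <= 5 / 16 * b.
  have := Xb _ _ t1 d1'; rewrite bilinZ; lra.
have h3 : bilin X v d <= 1 / 4 * b.
  have := Xb _ _ d1 v1.
  have -> : bilin X v (fun i => 4 * d i) =
      bilin X (fun i => 1 * v i) (fun i => 4 * d i).
    by apply: eq_bigr => i _; apply: eq_bigr => j _; rewrite mul1r.
  rewrite bilinZ; lra.
lra.
Qed.

(** The least admissible bound is the supremum of the form, finite by [op_le_entries]. Applying
    [net_step] to it gives sup <= U + (9/16) sup, hence sup <= (16/7) U. *)
Lemma op_le_net : op_le X (16 / 7 * U).
Proof.
have [c Xc] : exists c, op_le X c.
  exists (n%:R * \sum_i \sum_j `|X i j|); apply: op_le_entries => i j.
  rewrite (bigD1 i)//= (bigD1 j)//= -addrA ler_wpDr// addr_ge0//.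
    by apply: sumr_ge0.
  by apply: sumr_ge0 => k _; apply: sumr_ge0.
pose S := [set y : R | exists u v, [/\ \sum_i u i ^+ 2 <= 1, \sum_i v i ^+ 2 <= 1 &
    y = bilin X v u]]%classic.
have Sub b : op_le X b -> ubound S b.
  by move=> Xb y [u [v [u1 v1 ->]]]; exact: Xb.
have S0 : S (bilin X (fun=> 0) (fun=> 0)).
  by exists (fun=> 0), (fun=> 0); split => //; rewrite big1// => i _; rewrite expr0n.
have supS : has_sup S by split; [exists (bilin X (fun=> 0) (fun=> 0))|exists c;
    exact: Sub].
have Xs : op_le X (sup S).
  by move=> u v u1 v1; apply: sup_upper_bound => //; exists u, v.
have : sup S <= U + 9 / 16 * sup S.
  apply: ge_sup; first by exists (bilin X (fun=> 0) (fun=> 0)).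
  exact/Sub/net_step.
by move=> h; apply: op_leW Xs; lra.
Qed.

End Net.

(** * The operator norm of a discrete Gaussian matrix *)

Section NetCount.
Variable R : realType.

Lemma sum_gauss_le5 (T : nat) :
  \sum_(i < T.*2.+1) expR (- (1 * zval R i ^+ 2)) <= 5 :> R.
Proof.
rewrite /zval.
(* The sharper bound makes the induction telescope: the two new terms total at most 4/((T+1)(T+2)) =
   4/(T+1) - 4/(T+2). *)
suff : \sum_(i < T.*2.+1) expR (- (1 * (i%:R - T%:R) ^+ 2)) <= 5 - 4 / (T.+1)%:R :> R.
  by move=> /le_trans; apply; rewrite lerBlDr lerDl divr_ge0.
elim: T => [|T IH].
  rewrite big_ord1 subrr expr0n mulr0 oppr0 expR0; lra.
rewrite doubleS big_ord_recl big_ord_recr /=.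
rewrite (_ : \sum_(i < _) _ = \sum_(i < T.*2.+1) expR (- (1 * (i%:R - T%:R) ^+ 2)));
    last first.
  apply: eq_bigr => i _; rewrite /bump /= add1n -natr1 -[T.+1%:R]natr1.
  by congr (expR (- (_ * _ ^+ 2))); ring.
have E : expR (- (1 * (T.+1)%:R ^+ 2)) <= 2 / ((T.+1)%:R * (T.+2)%:R) :> R.
  rewrite mul1r expRN.
  have h := expR_ge1Dx ((T.+1)%:R ^+ 2 : R).
  have p1 : (0 : R) < 1 + (T.+1)%:R ^+ 2 by rewrite ltr_wpDr ?sqr_ge0.
  apply: (@le_trans _ _ (1 + (T.+1)%:R ^+ 2)^-1).
    by rewrite lef_pV2// posrE ?expR_gt0.
  rewrite -[leLHS]mul1r ler_pdivrMr// mulrAC ler_pdivlMr ?mulr_gt0//.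
  rewrite mul1r -[T.+2%:R]natr1; have : (0 : R) <= T.+1%:R by []. nra.
have -> : (0 - T.+1%:R) ^+ 2 = (T.+1)%:R ^+ 2 :> R by rewrite sub0r sqrrN.
have -> : ((bump 0 T.*2.+1)%:R - T.+1%:R) ^+ 2 = (T.+1)%:R ^+ 2 :> R.
  rewrite /bump /= add1n (_ : T.*2.+2 = (T.+1 + T.+1)%N); last by rewrite -addnn; lia.
  by rewrite natrD; congr (_ ^+ 2); ring.
have : 4 / (T.+1)%:R - 4 / (T.+2)%:R = 2 * (2 / ((T.+1)%:R * (T.+2)%:R)) :> R.
  have T0 : (0 : R) <= T%:R by [].
  rewrite -[T.+2%:R]natr1 -[T.+1%:R]natr1; field.
  by apply/andP; split; apply: lt0r_neq0; lra.
move: E IH; move: (expR _) (\sum_(i < _) _) (2 / _) (4 / _) (4 / _) => *; lra.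
Qed.

Definition netpred (n : nat) (z : {ffun 'I_n -> 'I_((5 * n).*2.+1)}) : bool :=
  \sum_i zval R (z i) ^+ 2 <= 25 * n%:R.

(** Each net point satisfies 1 <= exp(25 n) exp(-|z|^2), and the Gaussian sum over the whole box
    factors into n sums of size at most 5. *)
Lemma card_net (n : nat) : #|@netpred n|%:R <= (5 * expR 25) ^+ n :> R.
Proof.
rewrite -sum1_card natr_sum.
apply: (@le_trans _ _ (\sum_(z : {ffun 'I_n ->
    'I_((5 * n).*2.+1)}) expR (25 * n%:R) * gweight (fun=> 1) z)).
  rewrite [leLHS]big_mkcond; apply: ler_sum => z _.
  case: ifP => [zn|_]; last by rewrite mulr_ge0 ?expR_ge0 ?gweight_ge0.
  rewrite /gweight -expR_sum -expRD sumrN -[leLHS]expR0 ler_expR subr_ge0.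
  by under eq_bigr do rewrite mul1r.
rewrite -mulr_sumr -/(gtotal _ _) gtotalE exprMn mulrC expRM_natr.
rewrite ler_wpM2r ?exprn_ge0 ?expR_ge0//.
apply: (@le_trans _ _ (\prod_(i < n) 5)).
  apply: ler_prod => i _; rewrite sum_gauss_le5 andbT.
  by apply: sumr_ge0 => j _; rewrite expR_ge0.
by rewrite prodr_const card_ord.
Qed.

(** Each coordinate satisfies z_i^2 <= 25 n <= (5n)^2, so the vector fits in the box of half-width
    5n, as a shift of its centre. *)
Lemma net_lift (n : nat) (z : 'I_n -> int) :
  \sum_i (z i)%:~R ^+ 2 <= 25 * n%:R :> R ->
  exists2 y : {ffun 'I_n -> 'I_((5 * n).*2.+1)}, netpred y &
    forall i, zval R (y i) = (z i)%:~R.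
Proof.
move=> zn.
have z5 i : (`|z i| <= 5 * n)%N.
  have : (z i)%:~R ^+ 2 <= (25 * n * n)%:R :> R.
    apply: (@le_trans _ _ (25 * n%:R)).
      apply: le_trans zn; rewrite (bigD1 i)//= ler_wpDr// sumr_ge0// => j _.
      by rewrite sqr_ge0.
    by rewrite -natrM ler_nat; have := ltn_ord i; nia.
  rewrite -rmorphXn /= pmulrn ler_int; nia.
pose y0 : {ffun 'I_n -> 'I_((5 * n).*2.+1)} := [ffun=> inord (5 * n)].
have y0i : interior (5 * n) y0.
  by apply/forallP => i; rewrite ffunE inordK; rewrite -addnn; lia.
exists (shift z y0).
  rewrite /netpred; under eq_bigr do rewrite (zval_shift _ y0i (z5 _)).
  apply: le_trans zn; apply: ler_sum => i _.
  by rewrite /zval ffunE inordK ?subrr ?add0r//; rewrite -addnn; lia.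
move=> i; rewrite (zval_shift _ y0i (z5 _)) /zval ffunE inordK ?subrr ?add0r//;
    rewrite -addnn; lia.
Qed.
End NetCount.

Section NormEvent.
Variables (R : realType) (n m t T : nat) (J : finType) (eta K : R).
Hypotheses (n0 : (0 < n)%N) (m0 : (0 < m)%N).
Hypotheses (eta1 : eta <= 1) (etaK : (5 * expR 25) ^+ 2 * expR (- K) <= eta).
Hypothesis tK : K * m%:R ^+ 2 <= n%:R * t%:R ^+ 2.

Local Notation idx := ('I_n * 'I_n + J)%type.

(** With rate m^-2, a matrix entry x of [noise_mx] has weight exp(-x^2) on the grid of mesh 1/m. *)
Definition energy (i : idx) : R := if i is inl _ then m%:R ^- 2 else 0.

Lemma energy_ge0 i : 0 <= energy i.
Proof. by case: i => [ij|//]; rewrite /= invr_ge0 sqr_ge0. Qed.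

Definition noise_mx (v : {ffun idx -> 'I_(T.*2.+1)}) : 'M[R]_n :=
  \matrix_(i, j) (m%:R^-1 * zval R (v (inl (i, j)))).

(** Union bound over pairs of net vectors. For each pair the Chernoff bound, with tilt [t] times the
    rank-one integer matrix of the pair, gives at most exp(-K n), while there are at most (5 exp
    25)^(2n) pairs. *)
Lemma noise_norm_event :
  \sum_(v | ~~ `[< op_le (noise_mx v) (16 / 7 * (625 * n%:R * t%:R / (16 * m%:R))) >])
     gweight energy v <= eta * gtotal T energy.
Proof.
set U := 625 * n%:R * t%:R / (16 * m%:R).
pose zn := {ffun 'I_n -> 'I_((5 * n).*2.+1)}.
have nR : (0 : R) < n%:R by rewrite ltr0n.
have mR : (0 : R) < m%:R by rewrite ltr0n.
pose zi (y : zn) i : int := (y i)%:Z - (5 * n)%:Z.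
pose mu (yy : zn * zn) (i : idx) : int :=
  if i is inl (a, b) then t%:Z * zi yy.1 a * zi yy.2 b else 0.
pose lin yy (v : {ffun idx -> 'I_(T.*2.+1)}) : R :=
    \sum_i energy i * (mu yy i)%:~R * zval R (v i).
(* [E0] = (t/m)^2 (25 n)^2 bounds the energy of every tilt, so the Chernoff exponent is at most E0 -
   2 E0 <= -K n. It is also the tilted value of the net threshold: (t/m) 16 n U = E0. *)
pose E0 : R := 625 * n%:R ^+ 2 * t%:R ^+ 2 / m%:R ^+ 2.
have ziE y i : (zi y i)%:~R = zval R (y i) by rewrite /zi rmorphB.
have linE yy v : lin yy v = t%:R / m%:R *
    bilin (noise_mx v) (fun i => zval R (yy.1 i)) (fun i => zval R (yy.2 i)).
  rewrite /lin big_sumType /= [X in _ + X]big1 ?addr0; last by move=> i _;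
      rewrite mul0r mul0r.
  rewrite /bilin pair_big /= mulr_sumr; apply: eq_bigr => -[a b] _ /=.
  rewrite !rmorphM /= !ziE mxE; field; rewrite gt_eqF//.
have one yy : netpred R yy.1 -> netpred R yy.2 ->
   \sum_(v : {ffun idx -> 'I_(T.*2.+1)} | E0 <= lin yy v) gweight energy v <=
       expR (- (K * n%:R)) * gtotal T energy.
  move=> n1 n2; apply: (le_trans (gauss_chernoff T energy_ge0 (mu yy) E0)).
  rewrite ler_wpM2r ?(ltW (gtotal_gt0 _ _))// ler_expR.
  have -> : \sum_i energy i * (mu yy i)%:~R ^+ 2 =
    t%:R ^+ 2 / m%:R ^+ 2 * ((\sum_a zval R (yy.1 a) ^+ 2) *
        (\sum_b zval R (yy.2 b) ^+ 2)).
    rewrite big_sumType /= [X in _ + X]big1 ?addr0; last by move=> i _; rewrite mul0r.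
    rewrite big_distrlr /= pair_big /= mulr_sumr; apply: eq_bigr => -[a b] _ /=.
    by rewrite !rmorphM /= !ziE; field; rewrite gt_eqF.
  have h : (\sum_a zval R (yy.1 a) ^+ 2) * (\sum_b zval R (yy.2 b) ^+ 2) <=
      (25 * n%:R) * (25 * n%:R).
    by apply: ler_pM => //; apply: sumr_ge0 => ? _; rewrite sqr_ge0.
  have h2 : t%:R ^+ 2 / m%:R ^+ 2 * ((\sum_a zval R (yy.1 a) ^+ 2) *
      (\sum_b zval R (yy.2 b) ^+ 2)) <= E0.
    apply: (@le_trans _ _ (t%:R ^+ 2 / m%:R ^+ 2 * ((25 * n%:R) * (25 * n%:R)))).
      by rewrite ler_wpM2l// divr_ge0 ?sqr_ge0.
    by rewrite /E0 le_eqVlt; apply/orP; left; apply/eqP; field; rewrite gt_eqF.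
  have h3 : K * n%:R <= E0.
    rewrite /E0 ler_pdivlMr ?exprn_gt0//.
    have : n%:R * (K * m%:R ^+ 2) <= n%:R * (n%:R * t%:R ^+ 2) by rewrite ler_pM2l.
    have : 0 <= n%:R * (n%:R * t%:R ^+ 2) :> R by rewrite mulr_ge0// mulr_ge0// sqr_ge0.
    lra.
  lra.
apply: (@le_trans _ _ (\sum_(yy : zn * zn | netpred R yy.1 && netpred R yy.2)
   \sum_(v : {ffun idx -> 'I_(T.*2.+1)} | E0 <= lin yy v) gweight energy v)).
  under [leRHS]eq_bigr do rewrite big_mkcond.
  rewrite exchange_big /= [leLHS]big_mkcond /=; apply: ler_sum => v _.
  have s0 (P : pred (zn * zn)) : 0 <= \sum_(yy | P yy) (if E0 <=
      lin yy v then gweight energy v else 0).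
    by apply: sumr_ge0 => yy _; case: ifP => // _; rewrite gweight_ge0.
  case: ifP => [/asboolPn nop|_]; last exact: s0.
  have [yy [yy1 yy2]] : exists yy : zn *
      zn, (netpred R yy.1 && netpred R yy.2) /\ E0 <= lin yy v.
    apply: contrapT => /forallNP nyy; apply: nop; apply: op_le_net => // z z' z1 z2.
    rewrite leNgt; apply/negP => zb.
    have [y yn yE] := net_lift z1; have [y' yn' yE'] := net_lift z2.
    apply: (nyy (y, y')); split; first exact/andP.
    rewrite linE /=.
    have -> : bilin (noise_mx v) (fun i => zval R (y i)) (fun i => zval R (y' i)) =
      bilin (noise_mx v) (fun i => (z i)%:~R) (fun i => (z' i)%:~R).
      by apply: eq_bigr => i _; apply: eq_bigr => j _; rewrite yE yE'.
    apply: (@le_trans _ _ (t%:R / m%:R * (16 * n%:R * U))).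
      by rewrite /U /E0 le_eqVlt; apply/orP; left; apply/eqP; field; rewrite gt_eqF.
    by rewrite ler_wpM2l ?divr_ge0// ltW.
  by rewrite (bigD1 yy)//= yy2 ler_wpDr// s0.
apply: (@le_trans _ _ (\sum_(yy : zn *
    zn | netpred R yy.1 && netpred R yy.2) expR (- (K * n%:R)) * gtotal T energy)).
  by apply: ler_sum => yy /andP[? ?]; exact: one.
rewrite sumr_const -[leLHS]mulr_natl mulrA ler_wpM2r ?(ltW (gtotal_gt0 _ _))//.
have -> : #|[pred yy : zn * zn | netpred R yy.1 && netpred R yy.2]| =
    (#|@netpred R n| * #|@netpred R n|)%N.
  by rewrite -cardX; apply: eq_card => yy; rewrite !inE.
rewrite natrM -mulNr mulrC expRM_natr.
have c2 : (#|@netpred R n|%:R * #|@netpred R n|%:R) <= ((5 * expR 25) ^+ 2) ^+ n :> R.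
  by rewrite exprAC expr2; apply: ler_pM => //; exact: card_net.
apply: (@le_trans _ _ (((5 * expR 25) ^+ 2 * expR (- K)) ^+ n)).
  by rewrite exprMn mulrC ler_wpM2r// exprn_ge0// expR_ge0.
have e0 : 0 <= (5 * expR 25) ^+ 2 * expR (- K) by rewrite mulr_ge0 ?sqr_ge0 ?expR_ge0.
rewrite -[n in leLHS](prednK n0) exprS; apply: le_trans etaK.
by rewrite ler_piMr// exprn_ile1// (le_trans etaK).
Qed.
End NormEvent.

(** * The hard instances *)

Section TwoShifts.
Variables (R : realType) (T : nat) (I : finType) (e : I -> R).
Local Notation box := {ffun I -> 'I_(T.*2.+1)}.

(** Otherwise every [v] in [G] has at least M - 1 inaccurate shifts, each of weight at least [kap]
    times its own. For each shift, injectivity bounds the inaccurate mass reached by that of the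
    box, so (M - 1) kap times the mass of [G] stays below M C. *)
Lemma two_good_shifts (M D : nat) (b : 'I_M -> I ->
    int) (acc G : pred box) (kap C : R) :
  (0 < M)%N -> 0 <= kap ->
  (forall v, G v -> interior D v) -> (forall j i, `|b j i| <= D)%N ->
  (forall v j, G v -> kap * gweight e v <= gweight e (shift (b j) v)) ->
  \sum_(v | ~~ acc v) gweight e v < C ->
  M%:R * C <= (M%:R - 1) * kap * \sum_(v | G v) gweight e v ->
  exists v (j l : 'I_M), [/\ G v, (j < l)%N, acc (shift (b j) v) & acc (shift (b l) v)].
Proof.
move=> M0 k0 GD bD Gk accC MC; apply: contrapT => none.
pose F v := if acc v then 0 else gweight e v.
have F0 v : 0 <= F v by rewrite /F; case: ifP => // _; exact: gweight_ge0.
have FC : \sum_v F v < C.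
  by rewrite (le_lt_trans _ accC)// [leRHS]big_mkcond /= ler_sum// => v _;
      rewrite /F; case: (acc v).
have one v : G v -> (M%:R - 1) * kap * gweight e v <= \sum_j F (shift (b j) v).
  move=> Gv.
  have c1 : (#|[pred j | acc (shift (b j) v)]| <= 1)%N.
    rewrite leqNgt; apply/negP => /card_gt1P[j [l [/= aj al jl]]]; apply: none.
    move: jl; rewrite -(inj_eq val_inj) neq_ltn => /orP[jl|lj].
      by exists v, j, l.
    by exists v, l, j.
  apply: (@le_trans _ _ (\sum_(j | ~~ acc (shift (b j) v)) kap * gweight e v)).
    rewrite sumr_const -[leRHS]mulr_natl -mulrA ler_wpM2r ?mulr_ge0 ?gweight_ge0//.
    have := cardC [pred j | acc (shift (b j) v)]; rewrite card_ord => cM.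
    rewrite lerBlDr natr1 ler_nat -[leqLHS]cM -addn1 addnC leq_add//.
  rewrite big_mkcond /=; apply: ler_sum => j _; rewrite /F.
  by case: (acc _) => //=; exact: Gk.
have : (M%:R - 1) * kap * \sum_(v | G v) gweight e v <= M%:R * \sum_v F v.
  rewrite mulr_sumr; apply: (@le_trans _ _ (\sum_(v | G v) \sum_j F (shift (b j) v))).
    by apply: ler_sum => v Gv; exact: one.
  rewrite exchange_big /= mulr_natl -[M in leRHS]card_ord -sumr_const;
      apply: ler_sum => j _.
  by apply: (@sum_shift_le _ _ _ D).
move/(le_trans MC); apply/negP; rewrite -ltNge ltr_pM2l// ltr0n//.
Qed.
End TwoShifts.

Section Instance.
Variables (R : realType) (n r k : nat) (alg : nonadaptive_alg R n r k).
Local Notation QT := (r.-tuple (n.-tuple (k.-tuple bool))).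

Definition query_mx (Q : QT) : 'M[R]_(n, r) :=
  \matrix_(i, j) alg_decode alg (tnth (tnth Q j) i).

(** Non-adaptivity enters here: the coins alone determine the queries, so for fixed coins the output
    depends on the matrix only through its product with the query matrix. *)
Lemma estimate_eq (A A' : 'M[R]_n) (w : alg_space alg) :
  A *m query_mx (alg_query alg w) = A' *m query_mx (alg_query alg w) ->
  estimate A w = estimate A' w.
Proof.
move=> E; rewrite /estimate; congr (alg_output alg (w, _)).
apply: eq_from_tnth => j; apply: eq_from_tnth => i; rewrite !tnth_mktuple.
have /matrixP/(_ i j) := E; rewrite !mxE => E'.
transitivity (\sum_l A i l * query_mx (alg_query alg w) l j).
  by apply: eq_bigr => l _; rewrite !mxE.
by rewrite E'; apply: eq_bigr => l _; rewrite !mxE.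
Qed.

(** A projection is fixed for every possible query tuple, so that the hard distribution can be
    defined before the coins are. *)
Lemma exists_query_projections : exists H : QT -> 'M[R]_n, forall Q,
  [/\ H Q *m query_mx Q = 0, (H Q)^T = H Q, H Q *m H Q = H Q & (n - r)%:R <= \tr (H Q)].
Proof.
have /choice[H HP] : forall Q, exists H : 'M[R]_n,
    [/\ H *m query_mx Q = 0, H^T = H, H *m H = H & (n - r)%:R <= \tr H].
  by move=> Q; exact: exists_projection.
by exists H.
Qed.

End Instance.

Section Shifts.
Variables (R : realType) (n m T : nat) (J : finType) (s : R) (H : J -> 'M[R]_n).
Hypothesis m0 : (0 < m)%N.
Local Notation idx := ('I_n * 'I_n + J)%type.
Local Notation box := {ffun idx -> 'I_(T.*2.+1)}.

(* A shift by [s H_Q] is not a lattice vector.  Its fractional part is absorbed by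
   one extra coordinate for every [Q], so that [int_shift Q] moves
   [instance_mx] by exactly [s H_Q]; these coordinates are uniform (their
   [energy] is [0]), hence such a shift costs nothing there. *)
Definition int_shift (Q : J) (x : idx) : int :=
  match x with
  | inl (i, j) => Num.floor (s * m%:R * H Q i j)
  | inr Q' => if Q' == Q then m%:Z else 0
  end.

Definition frac_mx (Q : J) : 'M[R]_n :=
  \matrix_(i, j) (s * H Q i j - m%:R^-1 * (int_shift Q (inl (i, j)))%:~R).

Definition instance_mx (v : box) : 'M[R]_n :=
  noise_mx R m v + \matrix_(i, j) \sum_Q m%:R^-1 * zval R (v (inr Q)) * frac_mx Q i j.

Lemma frac_mx_bound Q i j : 0 <= frac_mx Q i j <= m%:R^-1.
Proof.
have mR : (0 : R) < m%:R by rewrite ltr0n.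
have -> : frac_mx Q i j = m%:R^-1 * (s * m%:R *
    H Q i j - (int_shift Q (inl (i, j)))%:~R).
  by rewrite mxE; field; rewrite gt_eqF.
have := floor_itv (s * m%:R * H Q i j); rewrite intrD1 => /andP[h1 h2].
rewrite mulr_ge0 ?invr_ge0 ?subr_ge0//= -[leRHS]mulr1 ler_wpM2l ?invr_ge0//.
by move: h1 h2; rewrite /=; lra.
Qed.

Lemma instance_mx_shift (Q : J) (j : nat) (v v' : box) :
  (forall x, zval R (v' x) = zval R (v x) + (j%:Z * int_shift Q x)%:~R) ->
  instance_mx v' = instance_mx v + (j%:R * s) *: H Q.
Proof.
have mR : (0 : R) < m%:R by rewrite ltr0n.
move=> vv'; apply/matrixP => a b; rewrite !mxE vv'.
have -> : \sum_Q0 m%:R^-1 * zval R (v' (inr Q0)) * frac_mx Q0 a b =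
    \sum_Q0 m%:R^-1 * zval R (v (inr Q0)) * frac_mx Q0 a b + j%:R * frac_mx Q a b.
  transitivity (\sum_Q0 (m%:R^-1 * zval R (v (inr Q0)) * frac_mx Q0 a b +
      (if Q0 == Q then j%:R * frac_mx Q a b else 0))).
    apply: eq_bigr => Q' _; rewrite vv' /=; case: eqP => [->|_].
      by rewrite rmorphM /= -!pmulrn; field; rewrite gt_eqF.
    by rewrite mulr0 !addr0.
  by rewrite big_split /= -big_mkcond big_pred1_eq.
by rewrite rmorphM /= mxE -!pmulrn; field; rewrite gt_eqF.
Qed.

(** The floor moves each entry of s H by at most 1/m, so its square is at most 2 (s H_ij)^2 + 2/m^2.
    The first parts sum to 2 s^2 tr H and the second to 2 n^2/m^2, both at most 2 s^2 n. *)
Lemma int_shift_sqr_sum (Q : J) : (H Q)^T = H Q -> H Q *m H Q = H Q ->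
  n%:R <= s ^+ 2 * m%:R ^+ 2 ->
  \sum_x energy R m x * (int_shift Q x)%:~R ^+ 2 <= 4 * s ^+ 2 * n%:R.
Proof.
move=> HT HH nm; have mR : (0 : R) < m%:R by rewrite ltr0n.
rewrite big_sumType /= [X in _ + X]big1 ?addr0; last by move=> i _; rewrite mul0r.
apply: (@le_trans _ _ (\sum_(ij : 'I_n * 'I_n) (2 * s ^+ 2 * H Q ij.1 ij.2 ^+ 2 + 2 *
    m%:R ^- 2))).
  apply: ler_sum => -[a b] _ /=; have := frac_mx_bound Q a b.
  rewrite mxE /=; set z := (Num.floor _)%:~R : R.
  have -> : m%:R ^- 2 * z ^+ 2 = (m%:R^-1 * z) ^+ 2 by rewrite exprMn exprVn.
  have -> : m%:R ^- 2 = m%:R^-1 ^+ 2 :> R by rewrite exprVn.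
  set y := m%:R^-1 * z; move: y m%:R^-1 (H Q a b) => y x h /andP[h1 h2].
  have : (s * h - y) ^+ 2 <= x ^+ 2 by rewrite lerXn2r ?nnegrE ?(le_trans h1 h2)//.
  have := sqr_ge0 (2 * (s * h) - y); nra.
rewrite big_split /= sumr_const card_prod card_ord -mulr_sumr.
have -> : \sum_(ij : 'I_n * 'I_n) H Q ij.1 ij.2 ^+ 2 = \tr (H Q).
  by rewrite -(projection_sqr_sum HT HH) pair_big.
have h1 := mxtrace_projection_le HT HH.
have h2 : 2 * m%:R ^- 2 *+ (n * n) <= 2 * s ^+ 2 * n%:R :> R.
  rewrite -[leLHS]mulr_natl mulrC -mulrA -mulrA ler_pM2l// mulrC ler_pdivrMr
      ?exprn_gt0// natrM.
  by rewrite mulrAC ler_wpM2r.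
have : 2 * s ^+ 2 * \tr (H Q) <= 2 * s ^+ 2 * n%:R
    by rewrite ler_wpM2l// mulr_ge0// sqr_ge0.
lra.
Qed.

Lemma int_shift_bound (Q : J) (D1 : nat) x : (H Q)^T = H Q -> H Q *m H Q = H Q ->
  0 <= s -> s + 1 <= D1%:R -> (`|int_shift Q x| <= D1 * m)%N.
Proof.
move=> HT HH s0 sD; have mR : (1 : R) <= m%:R by rewrite ler1n.
case: x => [[a b]|Q'] /=; last first.
  have D1p : (0 < D1)%N by rewrite -(ltr0n R); lra.
  by case: ifP => _; nia.
have := floor_itv (s * m%:R * H Q a b); rewrite intrD1.
set z := Num.floor _ => /andP[h1 h2].
have := projection_entry HT HH a b; rewrite ler_norml => /andP[l1 l2].
have sm : 0 <= s * m%:R by rewrite mulr_ge0.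
have e1 : s * m%:R * H Q a b <= s * m%:R by rewrite -[leRHS]mulr1 ler_wpM2l.
have e2 : - (s * m%:R) <= s * m%:R * H Q a b by rewrite -[leLHS]mulrN1 ler_wpM2l//.
have e3 : s * m%:R + 1 <= (D1 * m)%:R.
  rewrite natrM; apply: (@le_trans _ _ ((s + 1) * m%:R)); first lra.
  by rewrite ler_wpM2r.
have z1 : z%:~R <= ((D1 * m)%:Z)%:~R :> R by rewrite -pmulrn; lra.
have z2 : (- (D1 * m)%:Z)%:~R <= z%:~R :> R by rewrite rmorphN /= -pmulrn; lra.
move: z1 z2; rewrite !ler_int; lia.
Qed.

(** Each extra coordinate lies in [-K, K] after division by m and multiplies a matrix with entries
    at most 1/m. The correction thus has entries at most |J| K / m <= 1/n, hence operator norm at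
    most 1. *)
Lemma instance_op_le (v : box) (B0 : R) (K : nat) : T = (K * m)%N ->
  (0 < n)%N -> n%:R * #|J|%:R * K%:R <= m%:R :> R ->
  op_le (noise_mx R m v) B0 -> op_le (instance_mx v) (B0 + 1).
Proof.
move=> TK n0 hm hB; have mR : (0 : R) < m%:R by rewrite ltr0n.
have nR : (0 : R) < n%:R by rewrite ltr0n.
have -> : B0 + 1 = B0 + n%:R * n%:R^-1 by rewrite mulfV ?gt_eqF.
apply: op_leD => //; apply: op_le_entries => i j.
rewrite mxE; apply: (le_trans (ler_norm_sum _ _ _)).
apply: (@le_trans _ _ (\sum_(Q : J) K%:R * m%:R^-1)); last first.
  rewrite sumr_const -[leLHS]mulr_natl mulrA ler_pdivrMr// ler_pdivlMl//.
  by rewrite mulrA.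
apply: ler_sum => Q _; rewrite normrM ler_pM//.
  rewrite normrM normfV (ger0_norm (ltW mR)) ler_pdivrMl// mulrC -natrM -TK /zval
      ler_norml.
  have := ltn_ord (v (inr Q)); move: (nat_of_ord _) => z; rewrite ltnS => zT.
  have : (z%:R : R) <= (T.*2)%:R by rewrite ler_nat.
  rewrite -addnn natrD; have : (0 : R) <= z%:R by []. lra.
have /andP[h1 h2] := frac_mx_bound Q i j; by rewrite ger0_norm.
Qed.
End Shifts.

(** Serves to replace the ideal tilt 1/g of a Chernoff bound by an integer. *)
Lemma exists_nat_scale (R : realType) (g : R) : 0 < g ->
  exists t : nat, 1 <= t%:R * g <= 1 + g.
Proof.
move=> g0; exists (Num.truncn g^-1).+1.
have /truncn_itv/andP[h1 h2] : 0 <= g^-1 by rewrite invr_ge0 ltW.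
rewrite -ler_pdivrMr// mul1r (ltW h2) -natr1 mulrDl mul1r lerD2r -ler_pdivlMr//.
by rewrite mul1r.
Qed.

(** Chernoff with tilt t a: for x = t g in [1, 1 + g] the exponent is at most x^2 - 2 x g - 2 x K <=
    -(2K - 1) x <= -(2K - 1). *)
Lemma gauss_linear_event (R : realType) (T : nat) (I : finType) (e : I -> R)
    (a : I -> int) (g K : R) : (forall i, 0 <= e i) -> 0 < g -> 1 / 2 <= K ->
  \sum_i e i * (a i)%:~R ^+ 2 <= g ^+ 2 ->
  \sum_(v : {ffun I -> 'I_(T.*2.+1)} |
     g ^+ 2 + g * K <= \sum_i e i * (a i)%:~R * zval R (v i)) gweight e v <=
  expR (- (2 * K - 1)) * gtotal T e.
Proof.
move=> e0 g0 K12 ag; have [t /andP[t1 t2]] := exists_nat_scale g0.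
pose mu i : int := t%:Z * a i.
have := gauss_chernoff T e0 mu (t%:R * (g ^+ 2 + g * K)).
have tR : (0 : R) < t%:R by rewrite -(pmulr_lgt0 _ g0); lra.
have -> : \sum_i e i * (mu i)%:~R ^+ 2 = t%:R ^+ 2 * \sum_i e i * (a i)%:~R ^+ 2.
  rewrite mulr_sumr; apply: eq_bigr => i _; rewrite /mu rmorphM /= -pmulrn; ring.
have mE (v : {ffun I -> 'I_(T.*2.+1)}) : \sum_i e i * (mu i)%:~R * zval R (v i) =
    t%:R * \sum_i e i * (a i)%:~R * zval R (v i).
  rewrite mulr_sumr; apply: eq_bigr => i _; rewrite /mu rmorphM /= -pmulrn; ring.
under eq_bigl => v do rewrite mE ler_pM2l//.
move=> h; apply: (le_trans h); rewrite ler_wpM2r ?(ltW (gtotal_gt0 _ _))// ler_expR.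
have : t%:R ^+ 2 * \sum_i e i * (a i)%:~R ^+ 2 <= t%:R ^+ 2 * g ^+ 2.
  by rewrite ler_wpM2l// sqr_ge0.
have : t%:R * g * (t%:R * g - 1 - g) <= 0 by rewrite mulr_ge0_le0//; lra.
have : (t%:R * g - 1) * (2 * K - 1) >= 0 by rewrite mulr_ge0//; lra.
have : 0 <= t%:R * g * g by rewrite mulr_ge0//; lra.
move: (\sum_i _) => S; nra.
Qed.

Lemma sum_le_cover4 (R : realType) (I : finType) (P1 P2 P3 P4 : pred I) (F : I -> R) :
  (forall i, 0 <= F i) -> (forall i, [|| P1 i, P2 i, P3 i | P4 i]) ->
  \sum_i F i <= \sum_(i | P1 i) F i + (\sum_(i | P2 i) F i +
    (\sum_(i | P3 i) F i + \sum_(i | P4 i) F i)).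
Proof.
move=> F0 cov; rewrite (big_mkcond P1) (big_mkcond P2) (big_mkcond P3) (big_mkcond P4).
rewrite -!big_split /=; apply: ler_sum => i _; have := F0 i; have := cov i.
by case: (P1 i); case: (P2 i); case: (P3 i); case: (P4 i) => //= _; lra.
Qed.

(** * Two shifts estimated accurately for the same coins *)

Section GoodPair.
Variables (R : realType) (n r k : nat) (alg : nonadaptive_alg R n r k).
Local Notation QT := (r.-tuple (n.-tuple (k.-tuple bool))).
Variable H : QT -> 'M[R]_n.
Hypothesis HT : forall Q, (H Q)^T = H Q.
Hypothesis HH : forall Q, H Q *m H Q = H Q.
Variables (p eps delta s eta K1 K3 : R) (M D1 m K t : nat).
Hypotheses (n0 : (0 < n)%N) (m0 : (0 < m)%N) (M0 : (0 < M)%N) (K0 : (0 < K)%N).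
Hypotheses (s0 : 0 < s) (eta0 : 0 < eta) (eta1 : eta <= 1) (d0 : 0 <= delta).
Hypothesis sD1 : s + 1 <= D1%:R.
Hypothesis nm : n%:R <= s ^+ 2 * m%:R ^+ 2.
Hypothesis hK : (#|{: 'I_n * 'I_n + QT}| * (M * D1))%:R <= eta / 3 * K%:R :> R.
Hypothesis etaK1 : (5 * expR 25) ^+ 2 * expR (- K1) <= eta / 3.
Hypothesis tK1 : K1 * m%:R ^+ 2 <= n%:R * t%:R ^+ 2.
Hypothesis K3p : 1 / 2 <= K3.
Hypothesis etaK3 : expR (- (2 * K3 - 1)) <= eta / 3.

(** Here g^2 = 4 s^2 n bounds the energy of [int_shift], [u] is a tail threshold for the linear form
    paired with that shift, and [kap] bounds from below the density ratio along up to [M] shifts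
    when the form is below [u]. *)
Let g : R := 2 * s * Num.sqrt n%:R.
Let u : R := g ^+ 2 + g * K3.
Let kap : R := expR (- (2 * M%:R * u + M%:R ^+ 2 * g ^+ 2)).
Hypothesis deltaM : delta < (1 - M%:R^-1) * kap * (1 - eta).
Hypothesis Aacc : forall A, accurate alg p eps delta A.

Let T := (K * m)%N.
Let D := (M * D1 * m)%N.
Let e := @energy R n m QT.
Let B0 := 16 / 7 * (625 * n%:R * t%:R / (16 * m%:R)) : R.
Local Notation box := {ffun 'I_n * 'I_n + QT -> 'I_(T.*2.+1)}.

(** The coins are fixed first, by averaging over the noise; they determine the projection. The noise
    then avoids the edge of the box, a large linear form and a large operator norm, each failing on
    at most an [eta]/3 share, and [two_good_shifts] applies on the rest. *)
Lemma good_pair : exists (w : alg_space alg) (v : box) (j l : nat),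
  [/\ (j < l)%N, (l < M)%N, op_le (noise_mx R m v) B0,
      accurate_at p eps (instance_mx m s H v + (j%:R * s) *: H (alg_query alg w)) w &
      accurate_at p eps (instance_mx m s H v + (l%:R * s) *: H (alg_query alg w)) w].
Proof.
have etapos := eta0; have etale := eta1.
have e0 i : 0 <= e i by exact: energy_ge0.
have W0 : 0 < gtotal T e by exact: gtotal_gt0.
have MR : (0 : R) < M%:R by rewrite ltr0n.
have nR : (0 : R) < n%:R by rewrite ltr0n.
have mR : (0 : R) < m%:R by rewrite ltr0n.
have KR : (0 : R) < K%:R by rewrite ltr0n.
have g0 : 0 < g by rewrite !mulr_gt0// sqrtr_gt0.
have K30 : 0 <= K3 by apply: le_trans K3p; lra.
have u0 : 0 <= u by apply: addr_ge0; [exact: sqr_ge0|exact: mulr_ge0 (ltW g0) K30].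
(* The threshold times [M] is exactly (M - 1) kap (1 - eta) times the total mass, the form that
   [two_good_shifts] requires. *)
have [w wC] := @exists_few_inaccurate R n r k alg p eps delta
  ((1 - M%:R^-1) * kap * (1 - eta) * gtotal T e) box (gweight e)
  (instance_mx m s H) d0 (fun v => gweight_ge0 e v) (fun v => Aacc _)
  (etrans (ltr_pM2r W0 _ _) deltaM).
pose Q := alg_query alg w.
pose a := int_shift m s H Q.
pose b (j : 'I_M) x : int := j%:Z * a x.
pose S (v : box) : R := \sum_i e i * (a i)%:~R * zval R (v i).
pose G : pred box := fun v => [&& interior D v, ~~ (u <= S v) &
    `[< op_le (noise_mx R m v) B0 >]].
have ag : \sum_i e i * (a i)%:~R ^+ 2 <= g ^+ 2.
  apply: (le_trans (int_shift_sqr_sum m0 (HT Q) (HH Q) nm)).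
  by rewrite /g exprMn sqr_sqrtr ?(ltW nR)// exprMn; lra.
have bD j x : (`|b j x| <= D)%N.
  have := int_shift_bound m0 x (HT Q) (HH Q) (ltW s0) sD1.
  rewrite /b /D -/a => h; rewrite abszM -mulnA leq_mul//= ltnW//.
have GW : (1 - eta) * gtotal T e <= \sum_(v | G v) gweight e v.
  have DT : (D <= T)%N.
    rewrite /D /T leq_mul2r; apply/orP; right.
    rewrite -(ler_nat R); apply: (@le_trans _ _ (eta / 3 * K%:R)).
      apply: le_trans hK; rewrite ler_nat leq_pmull//.
      by apply/card_gt0P; exists (inl (Ordinal n0, Ordinal n0)).
    by rewrite -[leRHS]mul1r ler_wpM2r//; lra.
  have E1 : \sum_(v : box | ~~ interior D v) gweight e v <= eta / 3 * gtotal T e.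
    have TR : (0 : R) < T%:R by rewrite /T natrM mulr_gt0.
    rewrite -(ler_pM2l TR); apply: (le_trans (gauss_edge e0 DT)).
    rewrite mulrA ler_wpM2r ?(ltW W0)// -natrM /D /T mulnA natrM [(K * m)%:R]natrM.
    by rewrite [leRHS]mulrC mulrA ler_wpM2r.
  have E2 : \sum_(v : box | u <= S v) gweight e v <= eta / 3 * gtotal T e.
    apply: (le_trans (gauss_linear_event T e0 g0 K3p ag)).
    by rewrite ler_wpM2r// ltW.
  have E3 : \sum_(v : box | ~~ `[< op_le (noise_mx R m v) B0 >]) gweight e v <=
      eta / 3 * gtotal T e.
    by apply: noise_norm_event tK1 => //; lra.
  have : gtotal T e <= \sum_(v | G v) gweight e v +
     (\sum_(v : box | ~~ interior D v) gweight e v + (\sum_(v : box | u <=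
         S v) gweight e v +
      \sum_(v : box | ~~ `[< op_le (noise_mx R m v) B0 >]) gweight e v)).
    apply: sum_le_cover4 => [v|v]; first exact: gweight_ge0.
    by rewrite /G; case: (interior D v); case: (u <= S v); case: `[< _ >].
  move: E1 E2 E3; move: (\sum_(v | G v) _) (\sum_(v : box | ~~ interior D v) _).
  move: (\sum_(v : box | u <= S v) _) (\sum_(v : box | ~~ `[< _ >]) _) (gtotal T e).
  by move=> x1 x2 x3 x4 x5 E1 E2 E3 E4; lra.
have Gk v j : G v -> kap * gweight e v <= gweight e (shift (b j) v).
  move=> /and3P[vD]; rewrite -ltNge => vu _.
  rewrite (gweight_shift _ vD (bD j)) mulrC ler_wpM2l ?gweight_ge0// ler_expR.
  have -> : \sum_i e i * (b j i)%:~R * zval R (v i) = j%:R * S v.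
    by rewrite mulr_sumr; apply: eq_bigr => i _; rewrite /b rmorphM /= -pmulrn; ring.
  have -> : \sum_i e i * (b j i)%:~R ^+ 2 = j%:R ^+ 2 * \sum_i e i * (a i)%:~R ^+ 2.
    by rewrite mulr_sumr; apply: eq_bigr => i _; rewrite /b rmorphM /= -pmulrn; ring.
  have jM : (j%:R : R) <= M%:R by rewrite ler_nat ltnW.
  have h1 : j%:R * S v <= M%:R * u.
    by apply: (@le_trans _ _ (j%:R * u)); [rewrite ler_wpM2l// ltW|rewrite ler_wpM2r].
  have h2 : j%:R ^+ 2 * (\sum_i e i * (a i)%:~R ^+ 2) <= M%:R ^+ 2 * g ^+ 2.
    apply: ler_pM => //; rewrite ?sqr_ge0//; first by apply: sumr_ge0 => i _;
        rewrite mulr_ge0// sqr_ge0.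
    by rewrite lerXn2r// nnegrE.
  lra.
have MC : M%:R * ((1 - M%:R^-1) * kap * (1 - eta) * gtotal T e) <=
    (M%:R - 1) * kap * \sum_(v | G v) gweight e v.
  have -> : M%:R * ((1 - M%:R^-1) * kap * (1 - eta) * gtotal T e) =
    (M%:R - 1) * kap * ((1 - eta) * gtotal T e) by field; rewrite gt_eqF.
  by rewrite ler_wpM2l// mulr_ge0 ?expR_ge0// subr_ge0 ler1n.
have GD v : G v -> interior D v by case/and3P.
have [v [j [l [Gv jl aj al]]]] :=
  @two_good_shifts R T _ e M D b (fun v => accurate_at p eps (instance_mx m s H v) w)
      G kap _
   M0 (expR_ge0 _) GD bD Gk wC MC.
exists w, v, j, l; move: Gv => /and3P[vD _ /asboolP vB].
have shE (i : 'I_M) : instance_mx m s H (shift (b i) v) =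
    instance_mx m s H v + (i%:R * s) *: H Q.
  by apply: instance_mx_shift => // x; rewrite (zval_shift _ vD (bD i x)).
split; [exact: jl|exact: ltn_ord|exact: vB|rewrite -shE; exact: aj|rewrite -shE;
    exact: al].
Qed.
End GoodPair.

Lemma le_of_sqr_le (R : realType) (x y : R) : 0 <= y -> x ^+ 2 <= y ^+ 2 -> x <= y.
Proof. by move=> y0 xy; rewrite leNgt; apply/negP => yx; nra. Qed.

(** Both matrices yield the same estimate, yet their traces differ by at least s tr H >= s n / 2,
    while each error is at most eps n^(1/p) b. *)
Lemma accurate_pair_gap (R : realType) (n r k : nat) (alg : nonadaptive_alg R n r k)
    (p eps s b : R) (A H : 'M[R]_n) (w : alg_space alg) (j l : nat) :
  0 < p -> 0 <= eps -> 0 < s -> (j < l)%N -> (r.*2 <= n)%N ->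
  H *m query_mx alg (alg_query alg w) = 0 -> (n - r)%:R <= \tr H ->
  op_le (A + (j%:R * s) *: H) b -> op_le (A + (l%:R * s) *: H) b ->
  accurate_at p eps (A + (j%:R * s) *: H) w ->
      accurate_at p eps (A + (l%:R * s) *: H) w ->
  s * (n%:R / 2) <= 2 * eps * (n%:R `^ p^-1 * b).
Proof.
move=> p0 eps0 s0 jl rn HQ trH bj bl; rewrite /accurate_at.
have -> : estimate (A + (j%:R * s) *: H) w = estimate A w.
  by apply: estimate_eq; rewrite mulmxDl -scalemxAl HQ scaler0 addr0.
have -> : estimate (A + (l%:R * s) *: H) w = estimate A w.
  by apply: estimate_eq; rewrite mulmxDl -scalemxAl HQ scaler0 addr0.
rewrite !mxtraceD !mxtraceZ => hj hl.
have := le_trans hj (ler_wpM2l eps0 (schatten_norm_op_le p0 bj)).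
have := le_trans hl (ler_wpM2l eps0 (schatten_norm_op_le p0 bl)).
clear hj hl; move: (estimate A w) (\tr A) (n%:R `^ p^-1 * b) => t a c.
rewrite !ler_norml => /andP[h1 h2] /andP[h3 h4].
have nr : n%:R / 2 <= \tr H.
  apply: le_trans trH; rewrite ler_pdivrMr// -natrM ler_nat; lia.
have n20 : 0 <= n%:R / 2 :> R by rewrite divr_ge0.
have jl1 : j%:R + 1 <= l%:R :> R by rewrite natr1 ler_nat.
have : 0 <= (l%:R - j%:R - 1) * (s * \tr H).
  apply: mulr_ge0; first by lra.
  exact: mulr_ge0 (ltW s0) (le_trans n20 nr).
have : s * (n%:R / 2) <= s * \tr H by rewrite ler_pM2l.
move: (\tr H) (n%:R / 2) (l%:R : R) (j%:R : R) h1 h2 h3 h4 => x y z1 z2 *; lra.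
Qed.

Lemma noise_lower_bound (R : realType) (delta0 : R) : 0 < delta0 < 1 ->
  exists (M : nat) (B c2 : R), [/\ (0 < M)%N, 0 < B, 0 < c2 &
   forall (n r k : nat) (alg : nonadaptive_alg R n r k) (p eps delta s : R),
     (0 < n)%N -> (r.*2 <= n)%N -> 0 < p -> 0 <= eps -> 0 < delta <= delta0 ->
     0 < s -> s ^+ 2 * n%:R <= c2 * ln delta^-1 ->
     (forall A, accurate alg p eps delta A) ->
     s * (n%:R / 2) <= 2 * eps * (n%:R `^ p^-1 * (B * Num.sqrt n%:R + M%:R * s))].
Proof.
move=> /andP[d00 d01].
pose sd := Num.sqrt delta0; have sd0 : 0 < sd by rewrite sqrtr_gt0.
have sd2 : sd ^+ 2 = delta0 by rewrite sqr_sqrtr// ltW.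
have sd1 : sd < 1 by rewrite -[ltRHS]sqrtr1 ltr_sqrt.
(* This [eta] leaves sqrt(delta0) = 1 - 3 eta strictly below (1 - eta)^2, room for the losses 1/M <
   eta and eta. *)
have [eta [eta0 eta1 etaE]] : exists eta : R, [/\ 0 < eta, eta <= 1 & sd = 1 - 3 * eta].
  by exists ((1 - sd) / 3); split; lra.
pose M := (Num.truncn eta^-1).+1.
have MR : (0 : R) < M%:R by rewrite ltr0n.
have MV : M%:R^-1 < eta.
  have /truncn_itv/andP[_ h] : 0 <= eta^-1 by rewrite invr_ge0 ltW.
  by rewrite -[ltRHS]invrK ltf_pV2 ?posrE ?invr_gt0.
pose C0 : R := (5 * expR 25) ^+ 2.
have C00 : 0 < C0 by rewrite exprn_gt0// mulr_gt0 ?expR_gt0.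
pose q1 := `|ln (3 * C0 / eta)| + 1.
have q10 : 0 < q1 by rewrite ltr_wpDl.
have etaK1 : C0 * expR (- q1 ^+ 2) <= eta / 3.
  have X0 : 0 < 3 * C0 / eta by rewrite divr_gt0// mulr_gt0.
  have h : expR (ln (3 * C0 / eta)) <= expR (q1 ^+ 2).
    rewrite ler_expR; apply: (le_trans (ler_norm _)); rewrite /q1.
    have := normr_ge0 (ln (3 * C0 / eta)); move: `|_| => x x0; nra.
  move: h; rewrite lnK ?posrE// expRN => h.
  rewrite ler_pdivrMr ?expR_gt0//.
  have e30 : 0 < eta / 3 by lra.
  have : eta / 3 * (3 * C0 / eta) <= eta / 3 * expR (q1 ^+ 2)
      by apply: ler_wpM2l (ltW e30) _ _ h.
  by have -> : eta / 3 * (3 * C0 / eta) = C0 by field; rewrite gt_eqF.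
pose K3 := (`|ln (3 / eta)| + 1) / 2.
have K3p : 1 / 2 <= K3 by rewrite /K3 ler_pM2r ?invr_gt0// lerDr.
have K30 : 0 < K3 by lra.
have etaK3 : expR (- (2 * K3 - 1)) <= eta / 3.
  have -> : 2 * K3 - 1 = `|ln (3 / eta)| by rewrite /K3; field.
  have h : expR (ln (3 / eta)) <= expR `|ln (3 / eta)| by rewrite ler_expR ler_norm.
  move: h; rewrite lnK ?posrE ?divr_gt0// => h.
  have e3 : 0 < 3 / eta by rewrite divr_gt0.
  rewrite expRN -[leRHS]invrK invf_div lef_pV2 ?posrE ?expR_gt0//.
pose L0 := ln delta0^-1.
have L00 : 0 < L0 by rewrite ln_gt0// invf_gt1.
(* The first bound keeps the terms in g^2 of the exponent of [kap] below L/4, the second does the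
   same for the linear term 2 M K3 g; the latter uses L >= L0. *)
pose c2 := Num.min (1 / (16 * (2 * M%:R + M%:R ^+ 2))) (L0 / (4 * (8 * M%:R *
    K3) ^+ 2)).
have M2 : (0 : R) < 2 * M%:R + M%:R ^+ 2 by rewrite addr_gt0 ?mulr_gt0 ?exprn_gt0.
have MK : 0 < 8 * M%:R * K3 by rewrite !mulr_gt0.
have c20 : 0 < c2.
  by rewrite lt_min !divr_gt0// mulr_gt0// exprn_gt0.
exists M, (16 / 7 * (625 * (q1 + 1) / 16) + 1), c2; split; [exact: isT|lra|exact: c20|].
move=> n r k alg p eps delta s n0 rn p0 eps0 /andP[dl0 dl1] s0 sc Aacc.
pose L := ln delta^-1.
have L0L : L0 <= L by rewrite ler_ln ?posrE ?invr_gt0// lef_pV2 ?posrE.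
have Lp : 0 < L by exact: lt_le_trans L0L.
have nR : (0 : R) < n%:R by rewrite ltr0n.
pose q : R := Num.sqrt n%:R.
have qp : 0 < q by rewrite sqrtr_gt0.
have qn : q ^+ 2 = n%:R by rewrite sqr_sqrtr// ltW.
pose g := 2 * s * q.
have g0 : 0 < g by rewrite !mulr_gt0.
have g2 : g ^+ 2 <= 4 * c2 * L.
  have -> : g ^+ 2 = 4 * (s ^+ 2 * n%:R) by rewrite -qn /g; ring.
  by rewrite -mulrA ler_pM2l.
have kapL : 2 * M%:R * (g ^+ 2 + g * K3) + M%:R ^+ 2 * g ^+ 2 <= L / 2.
  have k1 : (2 * M%:R + M%:R ^+ 2) * g ^+ 2 <= L / 4.
    have : c2 <= 1 / (16 * (2 * M%:R + M%:R ^+ 2)) by rewrite ge_min lexx.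
    rewrite ler_pdivlMr ?mulr_gt0// => h.
    have : (2 * M%:R + M%:R ^+ 2) * g ^+ 2 <=
        (2 * M%:R + M%:R ^+ 2) * (4 * c2 * L) by rewrite ler_pM2l.
    have : (c2 * (16 * (2 * M%:R + M%:R ^+ 2))) * L <= 1 * L by rewrite ler_pM2r.
    lra.
  have k2 : 8 * M%:R * K3 * g <= L.
    apply: (le_of_sqr_le (ltW Lp)); rewrite exprMn.
    have : c2 <= L0 / (4 * (8 * M%:R * K3) ^+ 2) by rewrite ge_min lexx orbT.
    rewrite ler_pdivlMr ?mulr_gt0 ?exprn_gt0// => h.
    apply: (@le_trans _ _ ((8 * M%:R * K3) ^+ 2 * (4 * c2 * L))).
      by rewrite ler_pM2l ?exprn_gt0.
    apply: (@le_trans _ _ (L0 * L)).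
      by have := h; rewrite -(ler_pM2r Lp); lra.
    by rewrite expr2 ler_pM2r.
  lra.
have deltaM : delta < (1 - M%:R^-1) * expR (- (2 * M%:R * (g ^+ 2 + g * K3) +
    M%:R ^+ 2 * g ^+ 2)) * (1 - eta).
  (* [x] is sqrt(delta): one factor of delta = x x is at most sqrt(delta0) < (1 - eta)^2, the other
     at most the density ratio. *)
  pose x := expR (- (L / 2)).
  have x0 : 0 < x by exact: expR_gt0.
  have x2 : x ^+ 2 = delta.
    rewrite /x expr2 -expRD (_ : _ + _ = - L); last by field.
    by rewrite expRN /L lnK ?posrE ?invr_gt0// invrK.
  have xsd : x <= sd.
    by apply: (le_of_sqr_le (ltW sd0)); rewrite x2 sd2.
  have : x <= expR (- (2 * M%:R * (g ^+ 2 + g * K3) + M%:R ^+ 2 * g ^+ 2))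
      by rewrite ler_expR lerN2.
  move: (expR _) => kp xk; rewrite -x2 mulrAC expr2.
  have e1 : 0 < 1 - eta by lra.
  have e2 : (1 - eta) * (1 - eta) < (1 - M%:R^-1) * (1 - eta) by rewrite ltr_pM2r//;
      lra.
  have e3 : sd < (1 - eta) * (1 - eta).
    have := mulr_gt0 eta0 eta0; lra.
  apply: (@lt_le_trans _ _ ((1 - M%:R^-1) * (1 - eta) * x)).
    by rewrite ltr_pM2r//; lra.
  by rewrite ler_pM2l//; lra.
have [H HP] := exists_query_projections alg.
pose D1 := (Num.truncn (s + 1)).+1.
have sD1 : s + 1 <= D1%:R.
  have /truncn_itv/andP[_ h] : 0 <= s + 1 by lra.
  exact: ltW.
pose nI := (#|{: 'I_n * 'I_n + r.-tuple (n.-tuple (k.-tuple bool))}| * (M * D1))%N.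
pose K := (Num.truncn (nI%:R * (3 / eta))).+1.
have hK : nI%:R <= eta / 3 * K%:R.
  have /truncn_itv/andP[_ h] : 0 <= nI%:R * (3 / eta) :> R
      by rewrite mulr_ge0// divr_ge0// ltW.
  by rewrite mulrC -ler_pdivrMr ?divr_gt0// invf_div ltW.
pose N := #|{: r.-tuple (n.-tuple (k.-tuple bool))}|.
(* The mesh is chosen last: q/s gives n <= s^2 m^2, the summand q absorbs the rounding of [t] below,
   and the product makes the fractional correction small. *)
pose m := (Num.truncn (q / s + (q + n%:R * N%:R * K%:R))).+1.
have mX : q / s + (q + n%:R * N%:R * K%:R) <= m%:R.
  have /truncn_itv/andP[_ h] : 0 <= q / s + (q + n%:R * N%:R * K%:R).
    by rewrite !addr_ge0 ?divr_ge0 ?(ltW qp) ?(ltW s0)// !mulr_ge0.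
  exact: ltW.
have NK0 : 0 <= n%:R * N%:R * K%:R :> R by rewrite !mulr_ge0.
have qs0 : 0 < q / s by rewrite divr_gt0.
have mR : (0 : R) < m%:R by rewrite ltr0n.
have nm : n%:R <= s ^+ 2 * m%:R ^+ 2.
  rewrite -qn -exprMn ler_pXn2r ?nnegrE ?(ltW qp) ?mulr_ge0 ?(ltW s0)//.
  by rewrite mulrC -ler_pdivrMr//; lra.
have mNK : n%:R * N%:R * K%:R <= m%:R :> R by lra.
(* The tilt t/m is about q1 / sqrt n, so the noise norm bound, proportional to n t/m, is O(sqrt
   n). *)
pose t := (Num.truncn (q1 * m%:R / q)).+1.
have t0 : 0 <= q1 * m%:R / q by rewrite divr_ge0 ?(ltW qp)// mulr_ge0 ?(ltW q10).
have /truncn_itv/andP[t1 t2] := t0.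
have tl : q1 * m%:R <= t%:R * q by rewrite -ler_pdivrMr// ltW.
have tu : t%:R / m%:R <= (q1 + 1) / q.
  have : (t%:R - 1) * q <= q1 * m%:R.
    by rewrite -ler_pdivlMr// /t -natr1 addrK.
  rewrite ler_pdivrMr// mulrAC ler_pdivlMr//; lra.
have tK1 : q1 ^+ 2 * m%:R ^+ 2 <= n%:R * t%:R ^+ 2.
  rewrite -qn -!exprMn ler_pXn2r ?nnegrE ?mulr_ge0 ?(ltW q10) ?(ltW qp)//.
  by rewrite [leRHS]mulrC.
have [w [v [j [l [jl lM vB aj al]]]]] := @good_pair R n r k alg H
  (fun Q => let: And4 _ h _ _ := HP Q in h) (fun Q => let: And4 _ _ h _ := HP Q in h)
  p eps delta s eta (q1 ^+ 2) K3 M D1 m K t n0 isT isT isT s0 eta0 eta1 (ltW dl0) sD1 nm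
  hK etaK1 tK1 K3p etaK3 deltaM Aacc.
have [HQ HT HH trH] := HP (alg_query alg w).
have vI := instance_op_le s H (isT : (0 < m)%N) erefl n0 mNK vB.
have opj (i : nat) : (i < M)%N ->
    op_le (instance_mx m s H v + (i%:R * s) *: H (alg_query alg w))
    ((16 / 7 * (625 * (q1 + 1) / 16) + 1) * q + M%:R * s).
  move=> iM; have is0 : 0 <= i%:R * s by rewrite mulr_ge0// ltW.
  have := op_leD vI (op_leZ is0 (op_le_projection HT HH)).
  apply: op_leW; rewrite mulr1 lerD//; last by rewrite ler_pM2r// ler_nat ltnW.
  rewrite [leRHS]mulrDl lerD//.
    have -> : 16 / 7 * (625 * n%:R * t%:R / (16 * m%:R)) =
        16 / 7 * (625 / 16) * (n%:R * (t%:R / m%:R)) :> R by field; rewrite gt_eqF.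
    have -> : 16 / 7 * (625 * (q1 + 1) / 16) * q =
        16 / 7 * (625 / 16) * (q ^+ 2 * ((q1 + 1) / q)) by field; rewrite gt_eqF.
    have k0 : 0 < 16 / 7 * (625 / 16) :> R by lra.
    by rewrite (ler_pM2l k0) qn (ler_pM2l nR); exact: tu.
  by rewrite mul1r; apply: (le_of_sqr_le (ltW qp)); rewrite qn expr1n ler1n.
exact: accurate_pair_gap p0 eps0 s0 jl rn HQ trH (opj j (ltn_trans jl lM)) (opj l lM)
    aj al.
Qed.

(** * Few queries *)

(** Without queries all inputs get the same estimate. The 1 x 1 matrices lam^j are spaced so that (1
    - eps) lam = 2 > 1 + eps, so no two admit a common estimate; for large [M] averaging makes two
    of them accurate. *)
Lemma no_query_inaccurate (R : realType) (r k : nat) (alg : nonadaptive_alg R 1 r k)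
    (p eps delta : R) : 0 < p -> 0 < eps < 1 -> 0 < delta < 1 ->
  (forall A, accurate alg p eps delta A) -> (0 < r)%N.
Proof.
move=> p0 /andP[eps0 eps1] /andP[dl0 dl1] Aacc; rewrite lt0n; apply/eqP => r0; subst r.
pose lam := (1 + eps) / (1 - eps) + 1.
have lamE : (1 - eps) * lam = 2 by rewrite /lam; field; lra.
have lam1 : 1 < lam by rewrite /lam ltrDr divr_gt0//; lra.
have [M MP] : exists M : nat, delta * M%:R < M%:R - 1.
  exists (Num.truncn (1 - delta)^-1).+1.
  have d1 : 0 < 1 - delta by lra.
  have /truncn_itv/andP[_ h] : 0 <= (1 - delta)^-1 by rewrite invr_ge0 ltW.
  have : (1 - delta) * (1 - delta)^-1 <
      (1 - delta) * (Num.truncn (1 - delta)^-1).+1%:R by rewrite ltr_pM2l.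
  rewrite mulfV ?gt_eqF//; lra.
pose A (j : 'I_M) : 'M[R]_1 := (lam ^+ j)%:M.
have [|w wC] := @exists_few_inaccurate R 1 0 k alg p eps delta (M%:R - 1) 'I_M (fun=>
    1) A
  (ltW dl0) (fun=> ler01) (fun j => Aacc (A j)).
  by rewrite sumr_const card_ord.
have [j [l [jl aj al]]] : exists j l : 'I_M, [/\ (j <
    l)%N, accurate_at p eps (A j) w & accurate_at p eps (A l) w].
  have /card_gt1P[j [l [aj al jl]]] : (1 < #|[pred j | accurate_at p eps (A j) w]|)%N.
    move: wC; rewrite sumr_const.
    have := cardC [pred j | accurate_at p eps (A j) w]; rewrite card_ord => cM.
    rewrite -[in X in _ -> X](ltn_add2r #|[predC [pred j | accurate_at p eps (A j)
        w]]|) cM.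
    by rewrite ltrBrDr natr1 ltr_nat.
  move: jl; rewrite -(inj_eq val_inj) neq_ltn => /orP[jl|lj].
    by exists j, l; split; [exact: jl|exact: aj|exact: al].
  by exists l, j; split; [exact: lj|exact: al|exact: aj].
have estA (i : 'I_M) : estimate (alg := alg) (A i) w = estimate (alg := alg) 0 w.
  by apply: estimate_eq; apply/matrixP => a [].
have Apos (i : 'I_M) : `|A i ord0 ord0| = lam ^+ i.
  by rewrite mxE eqxx mulr1n ger0_norm// exprn_ge0//; lra.
move: aj al; rewrite /accurate_at !estA !(schatten_norm_1x1 _ p0) !Apos !mxtrace_scalar.
rewrite !mulr1n; move: (estimate _ _) => t;
    rewrite !ler_norml => /andP[_ h2] /andP[h3 _].
have lj0 : 0 < lam ^+ j by rewrite exprn_gt0//; lra.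
have ll : lam * lam ^+ j <= lam ^+ l by rewrite -exprS ler_weXn2l// ltW.
have h5 : (1 - eps) * (lam * lam ^+ j) <= (1 - eps) * lam ^+ l
    by rewrite ler_wpM2l//; lra.
move: h5; rewrite mulrA lamE => h5.
have : eps * lam ^+ j < 1 * lam ^+ j by rewrite ltr_pM2r.
by lra.
Qed.

(** If [delta] times the number of signed projections were below 1, some coins would be accurate on
    all of them, in particular on both signs of the projection for their own queries. Both give zero
    answers, and the Schatten 1-norm equals the trace, which is at least 1. *)
Lemma query_count_bound (R : realType) (n r k : nat) (alg : nonadaptive_alg R n r k)
    (eps delta : R) : (r < n)%N -> eps < 1 -> 0 < delta ->
  (forall A, accurate alg 1 eps delta A) -> ln delta^-1 <= (k * n * r).+1%:R.
Proof.
move=> rn eps1 dl0 Aacc.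
have [H HP] := exists_query_projections alg.
pose QT := r.-tuple (n.-tuple (k.-tuple bool)).
pose A (x : QT * bool) := if x.2 then H x.1 else - H x.1.
have card : #|{: QT * bool}| = (2 ^ (k * n * r).+1)%N.
  by rewrite card_prod /QT !card_tuple !card_bool -!expnM expnSr mulnA.
have le1 : 1 <= delta * (2 ^ (k * n * r).+1)%:R.
  rewrite leNgt; apply/negP => dC.
  have [|w wC] := @exists_few_inaccurate R n r k alg 1 eps delta 1 (QT *
      bool)%type (fun=> 1) A
    (ltW dl0) (fun=> ler01) (fun x => Aacc (A x)).
    by rewrite sumr_const card.
  have acc x : accurate_at 1 eps (A x) w.
    apply: contraTT wC => nx; rewrite -leNgt (bigD1 x)//= lerDl sumr_ge0//.
  have [HQ HT HH trH] := HP (alg_query alg w).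
  have := acc (alg_query alg w, true); have := acc (alg_query alg w, false).
  rewrite /accurate_at /A /= schatten_normN (schatten1_projection HT HH).
  have -> : estimate (- H (alg_query alg w)) w = estimate 0 w.
    by apply: estimate_eq; rewrite mulNmx HQ oppr0 mul0mx.
  have -> : estimate (H (alg_query alg w)) w = estimate 0 w.
    by apply: estimate_eq; rewrite HQ mul0mx.
  rewrite raddfN /=; have : 1 <= \tr (H (alg_query alg w)).
    by apply: le_trans trH; rewrite ler1n subn_gt0.
  move: (\tr _) (estimate _ _) => d t d1; rewrite !ler_norml => /andP[_ h1] /andP[h2 _].
  have : eps * d < 1 * d by rewrite ltr_pM2r//; lra.
  lra.
have dV : delta^-1 <= expR ((k * n * r).+1%:R).
  rewrite -[leLHS]mul1r ler_pdivrMr// mulrC (le_trans le1)// ler_pM2l//.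
  rewrite -[X in expR X]mulr1 expRM_natl natrX lerXn2r ?nnegrE ?expR_ge0//.
  by have := expR_ge1Dx (1 : R); lra.
by rewrite -[leRHS]expRK ler_ln// posrE ?invr_gt0 ?expR_gt0.
Qed.

(** * Choice of the dimension and the final bound *)

Lemma dimension_threshold (R : realType) (p : R) (M : nat) : 1 <= p -> (0 < M)%N ->
  exists2 N0 : nat, (2 <= N0)%N & forall (n : nat) (eps : R), (N0 <= n)%N ->
    0 < eps < 1 -> (p = 1 -> 8 * M%:R * eps < 1) ->
    8 * eps * M%:R * n%:R `^ p^-1 < n%:R.
Proof.
move=> p1 M0; have MR : (0 : R) < M%:R by rewrite ltr0n.
have [pE|pN1] := eqVneq p 1.
  exists 2 => // n eps n2 _ /(_ pE) h; rewrite pE invr1 powRr1//.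
  have nR : (0 : R) < n%:R by rewrite ltr0n (leq_trans _ n2).
  rewrite -[ltRHS]mul1r ltr_pM2r//; lra.
have p1' : 1 < p by rewrite lt_neqAle eq_sym pN1.
have pp : 0 < p by lra.
have al0 : 0 < 1 - p^-1 by rewrite subr_gt0 invf_lt1.
(* Beyond [X] the power n^(1 - 1/p) is at least 8 M. For p = 1 this exponent vanishes, hence the
   separate smallness condition on [eps]. *)
pose X := (8 * M%:R) `^ (1 - p^-1)^-1.
exists (Num.truncn X).+2 => // n eps nX /andP[eps0 eps1] _.
have nR : (0 : R) < n%:R by rewrite ltr0n (leq_trans _ nX).
have Xn : X <= n%:R.
  have /truncn_itv/andP[_ h] : 0 <= X by exact: powR_ge0.
  by rewrite (le_trans (ltW h))// ler_nat ltnW.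
have n8 : 8 * M%:R <= n%:R `^ (1 - p^-1).
  have -> : 8 * M%:R = X `^ (1 - p^-1).
    by rewrite /X -powRrM mulVf ?gt_eqF// powRr1// mulr_ge0.
  by rewrite ge0_ler_powR ?nnegrE ?powR_ge0// ltW.
have np : 0 < n%:R `^ p^-1 by rewrite powR_gt0.
have nE : n%:R `^ (1 - p^-1) * n%:R `^ p^-1 = n%:R.
  by rewrite -powRD ?subrK ?powRr1// gt_eqF ?implybT.
rewrite -[ltRHS]nE; apply: (@lt_le_trans _ _ (8 * M%:R * n%:R `^ p^-1)).
  have h : 0 < 8 * M%:R :> R by rewrite mulr_gt0.
  rewrite ltr_pM2r// mulrAC -[ltRHS]mulr1 ltr_pM2l//.
by rewrite ler_pM2r.
Qed.

Lemma mul3S_le (a b d : nat) : (a < b)%N -> (0 < d)%N ->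
  ((d * b * a).+1 <= 2 * d * b ^ 2)%N.
Proof.
move=> ab d0; have b0 : (0 < b)%N by exact: leq_ltn_trans ab.
apply: (@leq_trans (d * b * b).+1); first by rewrite ltnS leq_mul2l (ltnW ab) orbT.
have -> : (2 * d * b ^ 2 = d * b * b + d * b * b)%N.
  by rewrite -mulnn -mulnA mulnA mul2n -addnn mulnDl !mulnA.
by rewrite -addn1 leq_add2l !muln_gt0 d0 b0.
Qed.

Unset Implicit Arguments.

Theorem theoremE1 (R : realType) (p : R) (hp : 1 <= p)
  (delta0 : R) (hdelta0 : 0 < delta0 < 1) :
  exists2 c : R, 0 < c &
    forall (k : nat) (eps delta : R),
      (1 <= k)%N -> 0 < eps < 1 -> 0 < delta <= delta0 ->
    forall (r : nat -> nat) (alg : forall n : nat, nonadaptive_alg R n (r n) k),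
      (forall n : nat, (1 <= n)%N -> forall A : 'M[R]_n,
         accurate (alg n) p eps delta A) ->
      exists2 n : nat, (1 <= n)%N &
        c * (ln delta^-1 `^ (p / 2) / (eps `^ p * (k%:R + ln eps^-1)))
          <= (r n)%:R.
Proof.
have [M [B [c2 [M0 B0 c20 noise]]]] := noise_lower_bound hdelta0.
have [N0 N02 N0P] := dimension_threshold hp M0.
have p0 : 0 < p by lra.
have MR : (0 : R) < M%:R by rewrite ltr0n.
have NR : (2 : R) <= N0%:R by rewrite ler_nat.
(* A dimension n below c3 L^(p/2) / eps^p satisfies 8 eps B n^(1/p) < sqrt(c2 L); the 4 in [ka]
   leaves room for rounding n up. *)
pose c3 := (Num.sqrt c2 / (8 * B)) `^ p.
have c30 : 0 < c3 by rewrite powR_gt0// divr_gt0 ?sqrtr_gt0// mulr_gt0.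
pose ka := c3 / 4.
have ka0 : 0 < ka by rewrite /ka; lra.
(* Once c Y >= 1, the condition on [N0] makes ka Y reach the threshold dimension and exceed twice
   the query count; the condition on [M] serves the case p = 1 with large [eps]. *)
have [c [c0 cka cM]] : exists c : R, [/\ 0 < c, c * N0%:R <= ka & c * (32 * M%:R) <= 1].
  exists (Num.min (ka / N0%:R) (32 * M%:R)^-1); split.
  - by rewrite lt_min divr_gt0 ?invr_gt0 ?mulr_gt0//; lra.
  - by rewrite -ler_pdivlMr ?ge_min ?lexx//; lra.
  - by rewrite -ler_pdivlMr ?mulr_gt0// mul1r ge_min lexx orbT.
have sqr_mono (a b : R) : 0 <= a -> a <= b -> a ^+ 2 <= b ^+ 2.
  by move=> a0 ab; rewrite lerXn2r ?nnegrE// (le_trans a0).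
exists c => // k eps delta k1 heps hdl r alg Aacc.
have /andP[eps0 eps1] := heps; have /andP[dl0 dl1] := hdl.
have dlt1 : delta < 1 by move: hdelta0 => /andP[_]; lra.
have L0 : 0 < ln delta^-1 by rewrite ln_gt0// invf_gt1.
have l0 : 0 <= ln eps^-1 by rewrite ln_ge0// invf_ge1// ltW.
have kR : (1 : R) <= k%:R by rewrite ler1n.
set L := ln delta^-1 in L0 *; set y := ln eps^-1 in l0 *.
set Y := L `^ (p / 2) / (eps `^ p * (k%:R + y)).
have ep0 : 0 < eps `^ p by rewrite powR_gt0.
have Y0 : 0 < Y by rewrite divr_gt0 ?powR_gt0// mulr_gt0//; lra.
apply: contrapT => none.
have small n : (1 <= n)%N -> (r n)%:R < c * Y.
  by move=> n1; rewrite ltNge; apply/negP => h; apply: none; exists n.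
(* If c Y < 1, one query in dimension 1 already suffices for the claim. *)
have [cY|cY] := ltP (c * Y) 1.
  have := no_query_inaccurate p0 heps (introT andP (conj dl0 dlt1)) (Aacc 1%N isT).
  by rewrite -(ler_nat R); have := small 1%N isT; lra.
(* For p = 1 and eps >= 1/(8M), counting in dimension n just above c Y gives L <= 8 k (c Y)^2. Since
   Y eps k <= sqrt L, also k (c Y)^2 <= 64 c^2 M^2 L <= L/16, so L <= L/2. *)
have [/andP[/eqP pE h8]|case1] := boolP ((p == 1) && (1 <= 8 * M%:R * eps)).
  have /truncn_itv/andP[n1 n2] : 0 <= c * Y by rewrite mulr_ge0// ltW.
  set n := (Num.truncn (c * Y)).+1 in n2.
  have nY : n%:R <= 2 * (c * Y) by rewrite /n -natr1; lra.
  have rn : (r n < n)%N by rewrite -(ltr_nat R); have := small n isT; lra.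
  have Aacc1 A : accurate (alg n) 1 eps delta A by rewrite -pE; exact: Aacc.
  have := query_count_bound rn eps1 dl0 Aacc1; rewrite -/L => LK.
  have {}LK : L <= 2 * k%:R * n%:R ^+ 2.
    by apply: (le_trans LK); rewrite -natrX -!natrM ler_nat; exact: mul3S_le.
  have YE : Y * (eps * (k%:R + y)) = Num.sqrt L.
    rewrite /Y pE powRr1 ?(ltW eps0)// mul1r powR12_sqrt ?(ltW L0)// mulfVK//.
    by rewrite gt_eqF// mulr_gt0//; lra.
  have YL : (Y * eps * k%:R) ^+ 2 <= L.
    have ye0 : 0 < Y * eps by rewrite mulr_gt0.
    have h0 : 0 <= Y * eps * k%:R by rewrite mulr_ge0// ltW.
    have h : Y * eps * k%:R <= Y * (eps * (k%:R + y)) by rewrite mulrA ler_pM2l//; lra.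
    by rewrite -[leRHS](sqr_sqrtr (ltW L0)) -YE; exact: sqr_mono.
  have h1 : L <= 8 * k%:R * (c * Y) ^+ 2.
    apply: (le_trans LK); have : n%:R ^+ 2 <= (2 * (c * Y)) ^+ 2.
      exact: sqr_mono.
    by rewrite -(@ler_pM2l _ (2 * k%:R)) ?mulr_gt0//; lra.
  have h3 : (c * (32 * M%:R)) ^+ 2 <= 1.
    by rewrite -[leRHS](expr1n _ 2); apply: sqr_mono => //;
        rewrite mulr_ge0 ?mulr_ge0// ltW.
  have h4 : (c * Y) ^+ 2 * k%:R <= c ^+ 2 * (64 * M%:R ^+ 2) * L.
    have h5 : (c * Y) ^+ 2 * k%:R <= (c * (Y * (8 * M%:R * eps))) ^+ 2 * k%:R ^+ 2.
      apply: ler_pM; rewrite ?sqr_ge0//; last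
          by rewrite -[leLHS]mulr1 expr2 ler_pM2l//; lra.
      apply: sqr_mono; first by rewrite mulr_ge0// ltW.
      by rewrite ler_pM2l// -[leLHS]mulr1 ler_pM2l.
    apply: (le_trans h5).
    have -> : (c * (Y * (8 * M%:R * eps))) ^+ 2 * k%:R ^+ 2 =
      c ^+ 2 * (64 * M%:R ^+ 2) * (Y * eps * k%:R) ^+ 2 by ring.
    by rewrite ler_pM2l// !mulr_gt0 ?exprn_gt0.
  have : c ^+ 2 * (64 * M%:R ^+ 2) * L <= 1 / 16 * L.
    by rewrite ler_pM2r//; lra.
  lra.
have N0P' n : (N0 <= n)%N -> 8 * eps * M%:R * n%:R `^ p^-1 < n%:R.
  move=> N0n; apply: N0P => // pE; rewrite ltNge; apply: contra case1 => h.
  by rewrite pE eqxx.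
have kaY : N0%:R <= ka * Y.
  have : c * N0%:R * Y <= ka * Y by rewrite ler_pM2r.
  have : N0%:R * 1 <= N0%:R * (c * Y) by rewrite ler_pM2l//; lra.
  lra.
have /truncn_itv/andP[n1 n2] : 0 <= ka * Y by rewrite mulr_ge0// ltW.
set n := (Num.truncn (ka * Y)).+1 in n2.
have nY : n%:R <= 2 * (ka * Y) by rewrite /n -natr1; lra.
have N0n : (N0 <= n)%N by rewrite -(ler_nat R); lra.
have rn : ((r n).*2 <= n)%N.
  rewrite -(ler_nat R) -mul2n natrM.
  have : 2 * (c * Y) <= N0%:R * (c * Y) by rewrite ler_wpM2r//; lra.
  have : c * N0%:R * Y <= ka * Y by rewrite ler_pM2r.
  have := small n isT; lra.
have nR : (0 : R) < n%:R by rewrite ltr0n.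
pose q : R := Num.sqrt n%:R.
have q0 : 0 < q by rewrite sqrtr_gt0.
have qn : q ^+ 2 = n%:R by rewrite sqr_sqrtr// ltW.
(* The largest [s] allowed by [noise_lower_bound], with s^2 n = c2 L. *)
pose s := Num.sqrt (c2 * L) / q.
have sq0 : 0 < Num.sqrt (c2 * L) by rewrite sqrtr_gt0 mulr_gt0.
have s0 : 0 < s by rewrite divr_gt0.
have s2 : s ^+ 2 * n%:R <= c2 * L.
  rewrite -qn -exprMn /s mulfVK ?gt_eqF// sqr_sqrtr// mulr_ge0// ltW//.
have := noise n (r n) k (alg n) p eps delta s isT rn p0 (ltW eps0) hdl s0 s2 (Aacc n
    isT).
rewrite -/q; set x := n%:R `^ p^-1.
have x0 : 0 < x by rewrite powR_gt0.
(* [i1] and [i2] make each of the two right-hand terms of the noise inequality, with [M] and with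
   [B], less than s n / 4, against a left side of s n / 2. *)
have i1 : 8 * eps * M%:R * x < n%:R by exact: N0P'.
have i2 : 8 * eps * B * x < Num.sqrt (c2 * L).
  pose z := Num.sqrt (c2 * L) / (8 * B * eps).
  have z0 : 0 < z by rewrite divr_gt0// !mulr_gt0.
  have zE : z `^ p = c3 * (L `^ (p / 2) / eps `^ p).
    have -> : z = Num.sqrt c2 / (8 * B) * (L `^ 2^-1 * eps^-1).
      rewrite /z (sqrtrM _ (ltW c20)) (powR12_sqrt (ltW L0)); field.
      by rewrite !gt_eqF.
    have u0 : 0 <= Num.sqrt c2 / (8 * B)
        by rewrite divr_ge0 ?sqrtr_ge0// mulr_ge0// ltW.
    have e0 : 0 <= eps^-1 by rewrite invr_ge0 ltW.
    rewrite (powRM _ u0 (mulr_ge0 (powR_ge0 _ _) e0)) (powRM _ (powR_ge0 _ _) e0).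
    congr (_ * _).
    by rewrite -powRrM [2^-1 * p]mulrC -(powR_inv1 (ltW eps0)) -powRrM mulN1r powRN.
  (* The factor k + ln(1/eps) is at least 1, so removing it from the denominator only increases the
     value. *)
  have YX : Y <= L `^ (p / 2) / eps `^ p.
    rewrite /Y ler_pM2l ?powR_gt0// lef_pV2 ?posrE ?mulr_gt0//; last lra.
    by rewrite -[leLHS]mulr1 ler_pM2l//; lra.
  have nz : n%:R < z `^ p.
    rewrite zE; have : c3 * Y <= c3 * (L `^ (p / 2) / eps `^ p) by rewrite ler_pM2l.
    have := mulr_gt0 c30 Y0; move: nY; rewrite /ka; lra.
  have xz : x < z.
    have -> : z = (z `^ p) `^ p^-1 by rewrite -powRrM mulfV ?gt_eqF// powRr1// ltW.
    by rewrite gt0_ltr_powR ?nnegrE ?invr_gt0 ?powR_ge0.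
  have : 8 * B * eps * x < 8 * B * eps * z by rewrite ltr_pM2l// !mulr_gt0.
  have -> : 8 * B * eps * z = Num.sqrt (c2 * L)
      by rewrite /z mulrC mulfVK// gt_eqF// !mulr_gt0.
  lra.
have sqE : s * q = Num.sqrt (c2 * L) by rewrite /s mulfVK// gt_eqF.
have : s * (8 * eps * M%:R * x) < s * n%:R by rewrite ltr_pM2l.
have : q * (8 * eps * B * x) < q * (s * q) by rewrite ltr_pM2l// sqE.
have -> : q * (s * q) = s * n%:R by rewrite -qn; ring.
lra.
Qed.
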